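(* There exists a compact connected Polish abelian group $G$ admitting a computably metrized presentation such that the (discrete, torsion-free) Pontryagin dual $\widehat{G}$ has no computable presentation as a discrete group.
   Context: A computably metrized presentation of a Polish group $H$ is a dense sequence $(x_i)$ and a compatible complete metric $d$ such that $d(x_i,x_j)$ is a computable real uniformly in $i,j$ and the group operations are effectively continuous with respect to the basic open balls (balls with centres $x_i$ and positive rational radii): for each operation $f$ there is a c.e. family $F$ of pairs $(U,V)$ of basic open sets with $f(U)\subseteq V$ for all $(U,V)\in F$, and for every $x$ and basic open $E\ni f(x)$ there is basic open $D\ni x$ with $(D,E)\in F$. The Pontryagin dual $\widehat{G}$ is the group of continuous homomorphisms $G\to\mathbb{R}/\mathbb{Z}$ with pointwise addition and compact-open topology. A computable presentation of a countable discrete group is an isomorphic copy with domain $\subseteq\mathbb{N}$ in which the operations are computable. *)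

(* Defs.v *)
From HB Require Import structures.
From mathcomp Require Import all_boot all_order all_algebra.
From mathcomp Require Import generic_quotient ring_quotient.
From mathcomp Require Import all_classical all_reals all_analysis.

Set Implicit Arguments.
Unset Strict Implicit.
Unset Printing Implicit Defensive.

Import Order.TTheory GRing.Theory Num.Theory.
Import numFieldTopology.Exports.

Local Open Scope classical_set_scope.
Local Open Scope ring_scope.
Local Open Scope quotient_scope.

Inductive murec : Type :=
| Zero
| Succ
| Proj of nat
| Comp of murec & seq murec
| Prec of murec & murec
| Mu of murec.

(** [murec_eval e s y]: the program [e], run on the arguments [s], halts with value
    [y].  Missing arguments are read as 0 and superfluous ones are ignored.  In
    the [Prec] case [t] lists the successive values of the recursion, which is
    on the first argument; [Mu] searches for the value of the first argument of
    its body. *)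
Fixpoint murec_eval (e : murec) (s : seq nat) (y : nat) {struct e} : Prop :=
  match e with
  | Zero => y = 0%N
  | Succ => y = (head 0%N s).+1
  | Proj i => y = nth 0%N s i
  | Comp f gs =>
      exists2 t : seq nat,
        (fix evals (gs : seq murec) (t : seq nat) {struct gs} : Prop :=
           match gs, t with
           | [::], [::] => True
           | g :: gs', z :: t' => murec_eval g s z /\ evals gs' t'
           | _, _ => False
           end) gs t
        & murec_eval f t y
  | Prec f g =>
      exists t : nat -> nat,
        [/\ murec_eval f (behead s) (t 0%N),
            forall k, (k < head 0%N s)%N ->
              murec_eval g (k :: t k :: behead s) (t k.+1)
          & y = t (head 0%N s)]
  | Mu f =>
      murec_eval f (y :: s) 0%N /\
      forall k, (k < y)%N -> exists z, murec_eval f (k :: s) z.+1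
  end.

Definition halts (e : murec) (s : seq nat) : Prop := exists y, murec_eval e s y.

Definition computable_set (D : set nat) : Prop :=
  exists e, forall n, murec_eval e [:: n] (nat_of_bool `[< D n >]).

Definition computable3 (f : nat -> nat -> nat -> nat) : Prop :=
  exists e, forall i j k, murec_eval e [:: i; j; k] (f i j k).

(** A set of objects named by tuples of natural numbers is c.e. when the set of
    names is the domain of a partial recursive function. *)
Definition ce_set (I : Type) (code : I -> seq nat) (F : set I) : Prop :=
  exists e, forall i, F i <-> halts e (code i).

(** The rational [(a i j k - b i j k) / (c i j k + 1)] is within [2^-k] of
    [r i j]. *)
Definition uniformly_computable (R : realType) (r : nat -> nat -> R) : Prop :=
  exists a b c : nat -> nat -> nat -> nat,
    [/\ computable3 a, computable3 b, computable3 c &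
        forall i j k,
          `| r i j - ((a i j k)%:R - (b i j k)%:R) / (c i j k).+1%:R |
            <= 2%:R ^- k].

(** As usual for computable structures, the domain [D] is a computable set.
    The copy of [A] has domain [D] and operations [add], [opp], of which only
    the restrictions to [D] matter. *)
Definition has_computable_presentation (A : zmodType) : Prop :=
  exists (D : set nat) (add : nat -> nat -> nat) (opp : nat -> nat)
         (phi : A -> nat),
    [/\ computable_set D,
        exists e, forall m n, D m -> D n -> murec_eval e [:: m; n] (add m n),
        exists e, forall n, D n -> murec_eval e [:: n] (opp n),
        set_bij [set: A] D phi
      & (forall a b, phi (a + b) = add (phi a) (phi b)) /\
        (forall a, phi (- a) = opp (phi a))].

Definition complete_compatible_metric (R : realType) (T : topologicalType)
    (d : T -> T -> R) : Prop :=
  [/\ forall p q, d p q = 0 <-> p = q,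
      forall p q, d p q = d q p,
      forall p q r, d p r <= d p q + d q r,
      forall p : T, nbhs p =
        filter_from [set r : R | 0 < r] (fun r => [set q | d p q < r])
    & forall u : nat -> T,
        (forall e : R, 0 < e -> exists N, forall m n,
           (N <= m)%N -> (N <= n)%N -> d (u m) (u n) < e) ->
        exists l : T, u @ \oo --> l].

Definition polish (R : realType) (T : topologicalType) : Prop :=
  (exists2 S : set T, countable S & dense S) /\
  (exists d : T -> T -> R, complete_compatible_metric d).

(** The name of the basic open ball of centre [x centre] and radius
    [(radius_num + 1) / (radius_den + 1)]. *)
Record ball_name : Type :=
  BallName { centre : nat; radius_num : nat; radius_den : nat }.

Definition ball_code (b : ball_name) : seq nat :=
  [:: centre b; radius_num b; radius_den b].

Definition ball_code2 (b : ball_name * ball_name) : seq nat :=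
  ball_code b.1 ++ ball_code b.2.

Definition basic_ball (R : realType) (T : Type) (x : nat -> T)
    (d : T -> T -> R) (b : ball_name) : set T :=
  [set y | d (x (centre b)) y < (radius_num b).+1%:R / (radius_den b).+1%:R].

Definition basic_ball2 (R : realType) (T : Type) (x : nat -> T)
    (d : T -> T -> R) (b : ball_name * ball_name) : set (T * T) :=
  basic_ball x d b.1 `*` basic_ball x d b.2.

(** [U] and [V] list the basic open sets of the source and of the target,
    [cU] and [cV] encode their names. *)
Definition effectively_continuous (X Y I J : Type)
    (cU : I -> seq nat) (U : I -> set X) (cV : J -> seq nat) (V : J -> set Y)
    (f : X -> Y) : Prop :=
  exists F : set (I * J),
    [/\ ce_set (fun p => cU p.1 ++ cV p.2) F,
        forall i j, F (i, j) -> f @` U i `<=` V j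
      & forall x j, V j (f x) -> exists2 i, U i x & F (i, j)].

Definition computably_metrized_presentation (R : realType)
    (G : topologicalZmodType) (x : nat -> G) (d : G -> G -> R) : Prop :=
  [/\ dense (range x),
      complete_compatible_metric d,
      uniformly_computable (fun i j => d (x i) (x j)),
      effectively_continuous ball_code2 (basic_ball2 x d)
        ball_code (basic_ball x d) (fun p : G * G => p.1 + p.2)
    & effectively_continuous ball_code (basic_ball x d)
        ball_code (basic_ball x d) (fun p : G => - p)].

Section Circle.
Variable R : realType.

Definition int_pred : {pred R} := fun x => x \is a Num.int.

Lemma int_pred_zmod_closed : zmod_closed int_pred.
Proof. by split=> [|x y xZ yZ]; [exact: rpred0|exact: rpredB]. Qed.

HB.instance Definition _ :=
  GRing.isZmodClosed.Build R int_pred int_pred_zmod_closed.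

Definition circle : Type := quotient_topology (Quotient.quot int_pred).

HB.instance Definition _ := Topological.on circle.
HB.instance Definition _ := GRing.isZmodule.Build circle
  (@Quotient.addqA R int_pred) (@Quotient.addqC R int_pred)
  (@Quotient.add0q R int_pred) (@Quotient.addNq R int_pred).

Definition to_circle (x : R) : circle := \pi_(Quotient.quot int_pred) x.

Lemma to_circleB x y : to_circle (x - y) = to_circle x - to_circle y.
Proof. by rewrite /to_circle raddfB. Qed.

Lemma to_circle_surj (z : circle) : exists x, to_circle x = z.
Proof. by exists (repr (z : Quotient.quot int_pred)); exact: reprK. Qed.

Lemma to_circle_eq x y : to_circle x = to_circle y <-> x - y \is a Num.int.
Proof.
rewrite -[x - y \is a Num.int]/(x - y \in int_pred) Quotient.idealrBE.
by split=> [xy|/eqP]; first exact/eqP.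
Qed.

Lemma to_circle_continuous : continuous to_circle.
Proof. exact: pi_continuous. Qed.

Lemma to_circle_open (U : set R) : open U -> open (to_circle @` U).
Proof.
move=> oU.
suff: open (to_circle @^-1` (to_circle @` U)) by [].
have -> : to_circle @^-1` (to_circle @` U) =
    \bigcup_(n : int) ((fun x => x + n%:~R) @^-1` U).
  apply/seteqP; split=> [x [y Uy /to_circle_eq/intrP[n xyn]]|x [n _ Ux]].
    by exists n => //=; rewrite -xyn addrC subrK.
  by exists (x + n%:~R) => //; apply/to_circle_eq; rewrite addrC addKr intr_int.
apply: bigcup_open => n _; apply: open_comp => // x _.
by apply: cvgD; [exact: cvg_id|exact: cvg_cst].
Qed.

Lemma circle_sub_continuous : continuous (fun z : circle * circle => z.1 - z.2).
Proof.
move=> [a b] W /=.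
have [x <-] := to_circle_surj a; have [y <-] := to_circle_surj b.
rewrite -to_circleB => nW.
have : nbhs (x, y) ((fun z : R * R => z.1 - z.2) @^-1` (to_circle @^-1` W)).
  apply: (@sub_continuous R (x, y)); exact: to_circle_continuous.
have to_circle_nbhs (t : R) (A : set R) :
    nbhs t A -> nbhs (to_circle t) (to_circle @` A).
  rewrite nbhsE => -[B [oB Bt] BA]; rewrite nbhsE.
  exists (to_circle @` B); last exact: image_subset.
  by split; [exact: to_circle_open|exists t].
move=> [[A B] [/= nA nB] AB].
exists (to_circle @` A, to_circle @` B); first by split; exact: to_circle_nbhs.
move=> [_ _] [/= [u Au <-] [v Bv <-]]; rewrite -to_circleB.
exact: (AB (u, v)).
Qed.

HB.instance Definition _ :=
  PreTopologicalNmodule_isTopologicalZmodule.Build circle circle_sub_continuous.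

End Circle.

Section Dual.
Variables (R : realType) (G : topologicalZmodType).

Definition character : {pred G -> circle R} :=
  fun f => `[< continuous f /\ {morph f : x y / x + y} >].

Lemma character_zmod_closed : zmod_closed character.
Proof.
split=> [|f g /asboolP[cf fD] /asboolP[cg gD]]; apply/asboolP; split.
- by move=> x; exact: cvg_cst.
- by move=> x y; rewrite /= addr0.
- move=> x.
  apply: (@continuous_comp _ _ _ (fun y => (f y, g y))
    (fun z : circle R * circle R => z.1 - z.2)); last exact: sub_continuous.
  exact: (cvg_pair (cf x) (cg x)).
- by move=> x y; rewrite !fctE fD gD opprD addrACA.
Qed.

HB.instance Definition _ :=
  GRing.isZmodClosed.Build (G -> circle R) character character_zmod_closed.

Record dual : Type :=
  Character { dual_fun :> G -> circle R; _ : dual_fun \in character }.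

HB.instance Definition _ := [isSub for dual_fun].
HB.instance Definition _ := [Choice of dual by <:].
HB.instance Definition _ := [SubChoice_isSubZmodule of dual by <:].
HB.instance Definition _ :=
  Topological.copy dual
    (@initial_topology dual {compact-open, G -> circle R} dual_fun).

End Dual.

Definition discrete (T : topologicalType) : Prop :=
  @nbhs T T = principal_filter.

Definition torsion_free (A : zmodType) : Prop :=
  forall (a : A) (n : nat), (0 < n)%N -> a *+ n = 0 -> a = 0.

(* Main.v *)
(** Let [q n] be Sylvester's pairwise coprime sequence and let [S] be a co-c.e.
    set of numbers that is not c.e.  The group
    [G = {z in circle^nat | z (n + 1) *+ q n = z 0 for all n in S}] is dual to
    the group generated by [x, y 0, y 1, ...] with the relations
    [q n * y n = x] for [n] in [S].  In the dual, [x] is divisible by [q n]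
    exactly when [n] is in [S], so that a computable presentation would make
    [S] c.e.

    On the other hand [G] inherits a computable metric from the product of the
    circles.  It has a computable dense sequence because a number leaving [S]
    only makes [G] larger: a rational point of the Lie algebra of [G] carries
    for each [n] a candidate witness of "[n] is not in [S]"; coordinate
    [n + 1] is freely chosen when this witness is correct and is the value
    forced by coordinate 0 otherwise.  Density is the Chinese remainder
    theorem for the [q n]; the one-parameter subgroups through the dense points
    give connectedness and the absence of torsion in the dual. *)
Require Import Defs.
From HB Require Import structures.
From mathcomp Require Import all_boot all_order all_algebra.
From mathcomp Require Import ring lra.
From mathcomp Require Import all_classical all_reals all_analysis.

Set Implicit Arguments.
Unset Strict Implicit.
Unset Printing Implicit Defensive.

(** The rational points have to test candidate witnesses, so it is not enough that [S] is co-c.e.: a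
    total computable [Q] is needed such that [n] is outside [S] exactly when [Q (npair w n)] holds
    for some [w]. As [murec_eval] is a relation without step counts, [Q] is obtained by
    arithmetizing evaluation: derivations are coded by numbers and checked with bounded quantifiers.
    [S] is then the complement of the diagonal halting set.

    Coprimality of the [q n] serves twice: for density, and for producing, when [n] is outside [S],
    a point of [G] that is killed by [q n] and has coordinate 0 equal to [1 / q n]; such a point
    shows that [x] is not divisible by [q n]. Sylvester's sequence is coprime by construction and
    given by a one-line recursion.

    All effectivity rests on one function, the distance from [x i + x j] to [x l] up to [2^-k],
    where [x i] now denotes the dense sequence. As [x 0 = 0], it also yields the metric and
    inversion. The c.e. families for the operations consist of the inclusions of balls that the
    triangle inequality certifies. *)

Local Open Scope nat_scope.

(** * Computable functions *)

(** [cf] stands for computable function: of an object [i], the program sees the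
    list [code i]. *)
Definition cf (I : Type) (code : I -> seq nat) (f : I -> nat) : Prop :=
  exists e, forall i, murec_eval e (code i) (f i).

Definition code1 (x : nat) : seq nat := [:: x].
Definition code2 (p : nat * nat) : seq nat := [:: p.1; p.2].
Definition code3 (p : nat * nat * nat) : seq nat := [:: p.1.1; p.1.2; p.2].

Notation cf1 f := (cf code1 f).
Notation cf2 F := (cf code2 (fun p => F p.1 p.2)).
Notation cf3 F := (cf code3 (fun p => F p.1.1 p.1.2 p.2)).

Section Closure.
Variables (I : Type) (code : I -> seq nat).
Implicit Types f g h : I -> nat.

Lemma cf_ext f g : f =1 g -> cf code f -> cf code g.
Proof. by move=> fg [e ef]; exists e => i; rewrite -fg. Qed.

Lemma cf_nth j : cf code (fun i => nth 0 (code i) j).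
Proof. by exists (Proj j). Qed.

Lemma cf_comp1 F f : cf1 F -> cf code f -> cf code (fun i => F (f i)).
Proof.
move=> [eF hF] [e he]; exists (Comp eF [:: e]) => i.
by exists [:: f i]; [split|exact: hF].
Qed.

Lemma cf_comp2 F f g :
  cf2 F -> cf code f -> cf code g -> cf code (fun i => F (f i) (g i)).
Proof.
move=> [eF hF] [e he] [e' he']; exists (Comp eF [:: e; e']) => i.
by exists [:: f i; g i]; [do !split|exact: (hF (f i, g i))].
Qed.

Lemma cf_const0 : cf code (fun=> 0).
Proof. by exists Zero. Qed.

Lemma cf_succ f : cf code f -> cf code (fun i => (f i).+1).
Proof. by apply: (@cf_comp1 S); exists Succ. Qed.

Lemma cf_const n : cf code (fun=> n).
Proof. by elim: n => [|n IHn]; [exact: cf_const0|exact: cf_succ]. Qed.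

End Closure.

Lemma cf_arg1 : cf1 (fun x => x).
Proof. exact: (cf_nth code1 0). Qed.
Lemma cf_arg2_1 : cf code2 (fun p => p.1).
Proof. exact: (cf_nth code2 0). Qed.
Lemma cf_arg2_2 : cf code2 (fun p => p.2).
Proof. exact: (cf_nth code2 1). Qed.
Lemma cf_arg3_1 : cf code3 (fun p => p.1.1).
Proof. exact: (cf_nth code3 0). Qed.
Lemma cf_arg3_2 : cf code3 (fun p => p.1.2).
Proof. exact: (cf_nth code3 1). Qed.
Lemma cf_arg3_3 : cf code3 (fun p => p.2).
Proof. exact: (cf_nth code3 2). Qed.

(** A single parameter [x] suffices, since several can be packed into one number by the pairing
    below. *)
Lemma cf_rec (F : nat -> nat -> nat) b g :
  (forall x, F 0 x = b x) -> (forall n x, F n.+1 x = g n (F n x) x) ->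
  cf1 b -> cf3 g -> cf2 F.
Proof.
move=> F0 FS [eb hb] [eg hg]; exists (Prec eb eg) => -[n x] /=.
exists (fun k => F k x); split=> //= [|k _]; first by rewrite F0; exact: hb.
by rewrite FS; exact: (hg (k, F k x, x)).
Qed.

Ltac cf := repeat first
  [ assumption | exact: cf_arg1 | exact: cf_arg2_1 | exact: cf_arg2_2
  | exact: cf_arg3_1 | exact: cf_arg3_2 | exact: cf_arg3_3
  | match goal with
    | |- cf _ (fun _ => ?n) => exact: cf_const
    | |- cf _ (fun i => S _) => apply: cf_succ
    end ].

Lemma cf2_add : cf2 addn.
Proof. by apply: (@cf_rec addn id (fun _ a _ => a.+1)) => //; cf. Qed.

Lemma cf_add I (c : I -> seq nat) f g :
  cf c f -> cf c g -> cf c (fun i => f i + g i).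
Proof. exact: cf_comp2 cf2_add. Qed.

Lemma cf_mul I (c : I -> seq nat) f g :
  cf c f -> cf c g -> cf c (fun i => f i * g i).
Proof.
apply: (@cf_comp2 _ _ muln).
apply: (@cf_rec muln (fun=> 0) (fun _ a x => x + a)) => //; cf.
by apply: cf_add; cf.
Qed.

Lemma cf_pred I (c : I -> seq nat) f : cf c f -> cf c (fun i => (f i).-1).
Proof.
apply: (@cf_comp1 _ _ predn).
apply: (@cf_comp2 _ _ (fun n _ => n.-1) id id); cf.
by apply: (@cf_rec (fun n _ => n.-1) (fun=> 0) (fun n _ _ => n)) => //; cf.
Qed.

Lemma cf_sub I (c : I -> seq nat) f g :
  cf c f -> cf c g -> cf c (fun i => f i - g i).
Proof.
move=> hf hg; apply: (@cf_comp2 _ _ (fun a b => b - a) _ _ _ hg hf).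
apply: (@cf_rec (fun a b => b - a) id (fun _ a _ => a.-1)) => [x|n x||]; cf.
- by rewrite subn0.
- by rewrite subnS.
- by apply: cf_pred; cf.
Qed.

Lemma cf_expn I (c : I -> seq nat) f g :
  cf c f -> cf c g -> cf c (fun i => f i ^ g i).
Proof.
move=> hf hg; apply: (@cf_comp2 _ _ (fun a b => b ^ a) _ _ _ hg hf).
apply: (@cf_rec (fun a b => b ^ a) (fun=> 1) (fun _ a x => x * a))
  => [x|n x||]; cf.
- by [].
- by rewrite expnS.
- by apply: cf_mul; cf.
Qed.

Lemma cf_if I (c : I -> seq nat) (b : I -> bool) f g :
  cf c (fun i => nat_of_bool (b i)) -> cf c f -> cf c g ->
  cf c (fun i => if b i then f i else g i).
Proof.
move=> hb hf hg; apply: (@cf_ext _ _ (fun i => b i * f i + (1 - b i) * g i)).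
  by move=> i; case: (b i); rewrite !(mul1n, mul0n, addn0).
by apply: cf_add; apply: cf_mul; cf; apply: cf_sub; cf.
Qed.

Lemma cf_and I (c : I -> seq nat) (a b : I -> bool) :
  cf c (fun i => nat_of_bool (a i)) -> cf c (fun i => nat_of_bool (b i)) ->
  cf c (fun i => nat_of_bool (a i && b i)).
Proof.
move=> ha hb; apply: cf_ext (cf_mul ha hb) => i.
by rewrite mulnb.
Qed.

Lemma cf_not I (c : I -> seq nat) (a : I -> bool) :
  cf c (fun i => nat_of_bool (a i)) -> cf c (fun i => nat_of_bool (~~ a i)).
Proof.
move=> ha; apply: cf_ext (cf_sub (cf_const c 1) ha) => i /=.
by case: (a i).
Qed.

Lemma cf_leq I (c : I -> seq nat) f g : cf c f -> cf c g ->
  cf c (fun i => nat_of_bool (f i <= g i)).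
Proof.
move=> hf hg; apply: cf_ext (cf_sub (cf_const c 1) (cf_sub hf hg)) => i /=.
by rewrite -subn_eq0; case: (f i - g i).
Qed.

Lemma cf_eq I (c : I -> seq nat) f g : cf c f -> cf c g ->
  cf c (fun i => nat_of_bool (f i == g i)).
Proof.
move=> hf hg; apply: cf_ext (cf_and (cf_leq hf hg) (cf_leq hg hf)) => i.
by rewrite eqn_leq.
Qed.

Lemma cf_divn I (c : I -> seq nat) f g :
  cf c f -> cf c g -> cf c (fun i => f i %/ g i).
Proof.
apply: (@cf_comp2 _ _ divn).
(* The quotient grows by one exactly when one more multiple of [d] fits into [n.+1]; the guard
   [0 < d] reproduces the convention that division by 0 gives 0. *)
apply: (@cf_rec divn (fun=> 0)
  (fun n a d => a + nat_of_bool ((0 < d) && (a.+1 * d <= n.+1)))).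
- by move=> d; rewrite div0n.
- move=> n [|d]; first by rewrite !divn0.
  rewrite -leq_divRL// divnS//=.
  by case: (_ %| _) => /=; rewrite ?add1n ?add0n ?ltnSn ?ltnn ?addn1 ?addn0.
- by cf.
- by apply: cf_add; cf; apply: cf_and; apply: cf_leq; cf; apply: cf_mul; cf.
Qed.

Lemma cf_modn I (c : I -> seq nat) f g :
  cf c f -> cf c g -> cf c (fun i => f i %% g i).
Proof.
move=> hf hg; apply: cf_ext (cf_sub hf (cf_mul (cf_divn hf hg) hg)) => i /=.
by rewrite {1}(divn_eq (f i) (g i)) addKn.
Qed.

(** * Pairing and coding of finite sequences *)

HB.lock Definition npair (a b : nat) : nat := (a + b) ^ 2 + b.

Fixpoint isqrt (n : nat) : nat :=
  if n is m.+1 then isqrt m + ((isqrt m).+1 ^ 2 <= m.+1) else 0.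

HB.lock Definition npair_snd (n : nat) : nat := n - isqrt n ^ 2.
HB.lock Definition npair_fst (n : nat) : nat := isqrt n - npair_snd n.

Lemma isqrtP n : isqrt n ^ 2 <= n < (isqrt n).+1 ^ 2.
Proof.
elim: n => //= n /andP[le1 lt1].
case: (leqP ((isqrt n).+1 ^ 2) n.+1) => [le2|lt2]; last first.
  by rewrite addn0 (leq_trans le1).
rewrite addn1 le2 /=; apply: (leq_ltn_trans lt1).
by rewrite ltn_exp2r.
Qed.

Lemma isqrt_eq s n : s ^ 2 <= n < s.+1 ^ 2 -> isqrt n = s.
Proof.
move=> /andP[le1 lt1]; have /andP[le2 lt2] := isqrtP n.
apply/eqP; rewrite eqn_leq -ltnS -(ltn_exp2r _ _ (isT : 0 < 2)).
by rewrite (leq_ltn_trans le2)//= -ltnS -(ltn_exp2r _ _ (isT : 0 < 2))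
  (leq_ltn_trans le1).
Qed.

(** Since [b <= a + b], adding [b] to the square of [a + b] stays below the next square. The pairing
    is injective but not onto. *)
Lemma isqrt_pair a b : isqrt (npair a b) = a + b.
Proof.
have le_b : b <= a + b by rewrite leq_addl.
apply: isqrt_eq; rewrite npair.unlock leq_addr /=; move: (a + b) le_b => s le_b.
rewrite -(addn1 s) sqrnD -addnA ltn_add2l exp1n muln1 add1n ltnS.
by rewrite mul2n -addnn (leq_trans le_b)// leq_addr.
Qed.

Lemma npair_sndK a b : npair_snd (npair a b) = b.
Proof. by rewrite npair_snd.unlock isqrt_pair npair.unlock addKn. Qed.

Lemma npair_fstK a b : npair_fst (npair a b) = a.
Proof. by rewrite npair_fst.unlock npair_sndK isqrt_pair addnK. Qed.

Definition npairE := (npair_fstK, npair_sndK).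

Lemma isqrt_leq n : isqrt n <= n.
Proof.
have /andP[le1 _] := isqrtP n; apply: leq_trans le1.
by case: (isqrt n) => // m; rewrite -mulnn leq_pmulr.
Qed.

Lemma npair_fst_leq n : npair_fst n <= n.
Proof.
by rewrite npair_fst.unlock (leq_trans (leq_subr _ _) (isqrt_leq n)).
Qed.

Lemma npair_snd_leq n : npair_snd n <= n.
Proof. by rewrite npair_snd.unlock leq_subr. Qed.

Section PairClosure.
Variables (I : Type) (c : I -> seq nat) (f g : I -> nat).
Hypotheses (hf : cf c f) (hg : cf c g).

Lemma cf_pair : cf c (fun i => npair (f i) (g i)).
Proof.
by rewrite npair.unlock; apply: cf_add hg; apply: cf_expn;
  [exact: cf_add|exact: cf_const].
Qed.

Lemma cf_isqrt : cf c (fun i => isqrt (f i)).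
Proof.
apply: (@cf_comp2 _ _ (fun n _ => isqrt n) f f) => //.
apply: (@cf_rec (fun n _ => isqrt n) (fun=> 0)
  (fun n a _ => a + (a.+1 ^ 2 <= n.+1))) => //; cf.
by apply: cf_add; cf; apply: cf_leq; cf; apply: cf_expn; cf.
Qed.

End PairClosure.

Lemma cf_npair_snd I (c : I -> seq nat) f :
  cf c f -> cf c (fun i => npair_snd (f i)).
Proof.
rewrite npair_snd.unlock => hf; apply: cf_sub => //.
by apply: cf_expn; cf; exact: cf_isqrt.
Qed.

Lemma cf_npair_fst I (c : I -> seq nat) f :
  cf c f -> cf c (fun i => npair_fst (f i)).
Proof.
rewrite npair_fst.unlock => hf.
by apply: cf_sub; [exact: cf_isqrt|exact: cf_npair_snd].
Qed.

(** Every number is read as an infinite sequence that is eventually 0 when it comes from a list.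
    Lengths are not recorded, in accordance with [murec_eval], which reads missing arguments as
    0. *)
Definition sdrop (s i : nat) : nat := iter i npair_snd s.
Definition snth (s i : nat) : nat := npair_fst (sdrop s i).

Lemma sdropS s i : sdrop s i.+1 = sdrop (npair_snd s) i.
Proof. by rewrite /sdrop iterSr. Qed.

Lemma snth0 s : snth s 0 = npair_fst s. Proof. by []. Qed.

Lemma snthS s i : snth s i.+1 = snth (npair_snd s) i.
Proof. by rewrite /snth sdropS. Qed.

Lemma snth_leq s i : snth s i <= s.
Proof.
apply: leq_trans (npair_fst_leq _) _.
by elim: i => //= i IHi; apply: leq_trans (npair_snd_leq _) IHi.
Qed.

Definition senc (l : seq nat) : nat := foldr npair 0 l.

Lemma snth_0 i : snth 0 i = 0.
Proof. by apply/eqP; rewrite -leqn0 snth_leq. Qed.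

Lemma snth_senc l i : snth (senc l) i = nth 0 l i.
Proof.
elim: l i => [|x l IHl] [|i] //=.
- by rewrite snth_0.
- by rewrite snth_0.
- by rewrite snth0 npair_fstK.
- by rewrite snthS npair_sndK IHl.
Qed.

Lemma cf_snth I (c : I -> seq nat) f g :
  cf c f -> cf c g -> cf c (fun i => snth (f i) (g i)).
Proof.
move=> hf hg; apply: cf_npair_fst.
apply: (@cf_comp2 _ _ (fun n s => sdrop s n) g f) => //.
apply: (@cf_rec (fun n s => sdrop s n) id (fun _ a _ => npair_snd a)) => //; cf.
by apply: cf_npair_snd; cf.
Qed.

Ltac cf_all := repeat first
  [ progress cf
  | match goal with
    | |- cf _ (fun _ => addn _ _) => apply: cf_add
    | |- cf _ (fun _ => muln _ _) => apply: cf_mul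
    | |- cf _ (fun _ => subn _ _) => apply: cf_sub
    | |- cf _ (fun _ => expn _ _) => apply: cf_expn
    | |- cf _ (fun _ => divn _ _) => apply: cf_divn
    | |- cf _ (fun _ => modn _ _) => apply: cf_modn
    | |- cf _ (fun _ => npair _ _) => apply: cf_pair
    | |- cf _ (fun _ => npair_fst _) => apply: cf_npair_fst
    | |- cf _ (fun _ => npair_snd _) => apply: cf_npair_snd
    | |- cf _ npair_fst => exact: (cf_npair_fst cf_arg1)
    | |- cf _ npair_snd => exact: (cf_npair_snd cf_arg1)
    | |- cf _ (fun _ => snth _ _) => apply: cf_snth
    | |- cf _ (fun _ => nat_of_bool (leq _ _)) => apply: cf_leq
    | |- cf _ (fun _ => nat_of_bool (_ == _)) => apply: cf_eq
    | |- cf _ (fun _ => nat_of_bool (_ && _)) => apply: cf_and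
    | |- cf _ (fun _ => nat_of_bool (~~ _)) => apply: cf_not
    | |- cf _ (fun _ => if _ then _ else _) => apply: cf_if
    end ].

(** * Sigma_1 predicates and a universal one *)
Definition sigma1 (A : nat -> Prop) : Prop :=
  exists2 Q : nat -> bool, cf1 (fun x => nat_of_bool (Q x)) &
    forall x, A x <-> exists w, Q (npair w x).

Lemma sigma1_dec (Q : nat -> bool) :
  cf1 (fun x => nat_of_bool (Q x)) -> sigma1 Q.
Proof.
move=> hQ; exists (fun x => Q (npair_snd x)) => [|x].
  by apply: (@cf_comp1 _ _ (fun x => nat_of_bool (Q x))) => //; cf_all.
by split=> [Qx|[w]]; [exists 0|]; rewrite npair_sndK.
Qed.

Lemma sigma1_ext A B : (forall x, A x <-> B x) -> sigma1 A -> sigma1 B.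
Proof. by move=> AB [Q hQ AQ]; exists Q => // x; rewrite -AB. Qed.

Lemma sigma1_eq f g : cf1 f -> cf1 g -> sigma1 (fun x => f x = g x).
Proof.
move=> hf hg; apply: (@sigma1_ext (fun x => f x == g x)) => [x|].
  by split=> /eqP.
by apply: sigma1_dec; cf_all.
Qed.

Lemma sigma1_lt f g : cf1 f -> cf1 g -> sigma1 (fun x => f x < g x).
Proof. by move=> hf hg; apply: sigma1_dec; cf_all. Qed.

Lemma sigma1_and A B : sigma1 A -> sigma1 B -> sigma1 (fun x => A x /\ B x).
Proof.
move=> [Q hQ AQ] [Q' hQ' BQ].
exists (fun z => Q (npair (npair_fst (npair_fst z)) (npair_snd z)) &&
                 Q' (npair (npair_snd (npair_fst z)) (npair_snd z))) => [|x].
  cf_all; [apply: (@cf_comp1 _ _ (fun x => nat_of_bool (Q x)))|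
           apply: (@cf_comp1 _ _ (fun x => nat_of_bool (Q' x)))] => //; cf_all.
rewrite AQ BQ; split=> [[[w Qw] [w' Qw']]|[w]].
  by exists (npair w w'); rewrite !npairE Qw.
by rewrite npair_sndK => /andP[? ?]; split; eexists; eassumption.
Qed.

Lemma sigma1_ex (A : nat -> nat -> Prop) :
  sigma1 (fun x => A (npair_fst x) (npair_snd x)) ->
  sigma1 (fun x => exists y, A y x).
Proof.
move=> [Q hQ AQ].
exists (fun z => Q (npair (npair_fst (npair_fst z))
                     (npair (npair_snd (npair_fst z)) (npair_snd z)))) => [|x].
  by apply: (@cf_comp1 _ _ (fun x => nat_of_bool (Q x))) => //; cf_all.
split=> [[y]|[w]].
  have := AQ (npair y x); rewrite !npairE => -> [w Qw].
  by exists (npair w y); rewrite !npairE.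
rewrite npair_sndK => Qw; exists (npair_snd (npair_fst (npair w x))).
have := AQ (npair (npair_snd (npair_fst (npair w x))) x); rewrite !npairE => ->.
by exists (npair_fst w); move: Qw; rewrite !npairE.
Qed.

Lemma sigma1_or A B : sigma1 A -> sigma1 B -> sigma1 (fun x => A x \/ B x).
Proof.
move=> [Q hQ AQ] [Q' hQ' BQ].
exists (fun z => ~~ (~~ Q z && ~~ Q' z)) => [|x]; first by cf_all.
rewrite AQ BQ; split=> [[[w Qw]|[w Qw]]|[w]].
- by exists w; rewrite Qw.
- by exists w; rewrite Qw andbF.
- by rewrite negb_and !negbK => /orP[?|?]; [left|right]; exists w.
Qed.

Definition ball_upto (Q : nat -> bool) n := all Q (iota 0 n).

Lemma ball_uptoP (Q : nat -> bool) n :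
  reflect (forall k, k < n -> Q k) (ball_upto Q n).
Proof.
apply: (iffP allP) => h k; first by move=> kn; apply: h; rewrite mem_iota.
by rewrite mem_iota => /andP[_]; exact: h.
Qed.

Lemma cf_ball_upto I (c : I -> seq nat) (Q : nat -> nat -> bool) f g :
  cf2 (fun k x => nat_of_bool (Q k x)) -> cf c f -> cf c g ->
  cf c (fun i => nat_of_bool (ball_upto (Q^~ (g i)) (f i))).
Proof.
move=> hQ.
apply: (@cf_comp2 _ _ (fun n x => nat_of_bool (ball_upto (Q^~ x) n))).
apply: (@cf_rec (fun n x => nat_of_bool (ball_upto (Q^~ x) n)) (fun=> 1)
  (fun n a x => a * Q n x)) => [x|n x||] //.
- by rewrite /ball_upto -addn1 iotaD all_cat /= andbT mulnb.
- by cf.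
- by cf_all; apply: (@cf_comp2 _ _ (fun k x => nat_of_bool (Q k x))) => //; cf.
Qed.

(** The finitely many witnesses, one for each [k < t x], are bundled into the code of their
    sequence. *)
Lemma sigma1_all (A : nat -> nat -> Prop) t : cf1 t ->
  sigma1 (fun x => A (npair_fst x) (npair_snd x)) ->
  sigma1 (fun x => forall k, k < t x -> A k x).
Proof.
move=> ht [Q hQ AQ].
exists (fun z => ball_upto (fun k =>
    Q (npair (snth (npair_fst z) k) (npair k (npair_snd z))))
    (t (npair_snd z))) => [|x].
  apply: (@cf_ball_upto _ _ (fun k z =>
    Q (npair (snth (npair_fst z) k) (npair k (npair_snd z))))).
  + by apply: (@cf_comp1 _ _ (fun x => nat_of_bool (Q x))) => //; cf_all.
  + by apply: (@cf_comp1 _ _ t) => //; cf_all.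
  + by cf.
split=> [h|[w /ball_uptoP]]; last first.
  rewrite !npairE => h k /h kQ.
  by have := AQ (npair k x); rewrite !npairE => ->; eexists; eassumption.
have /choice[f fQ] : forall k, exists w, k < t x -> Q (npair w (npair k x)).
  move=> k; case: (boolP (k < t x)) => [/h|_]; last by exists 0.
  by have := AQ (npair k x); rewrite !npairE => -> [w ?]; exists w.
exists (senc (mkseq f (t x))); apply/ball_uptoP => k.
rewrite !npairE => kt; rewrite snth_senc nth_mkseq //.
exact: fQ.
Qed.

(** * Derivations as finite certificates of evaluation *)

Section Derivations.
Implicit Types (X : nat -> nat -> nat -> Prop) (c s y : nat).

(** One rule per constructor of [murec]; the codes 6 and 7 are those of the
    empty and nonempty lists of the inner programs of a composition. *)
Definition rule X c s y : Prop :=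
  let a := npair_snd c in let a1 := npair_fst a in let a2 := npair_snd a in
  (npair_fst c = 0 /\ y = 0) \/
  (npair_fst c = 1 /\ y = (npair_fst s).+1) \/
  (npair_fst c = 2 /\ y = snth s a) \/
  (npair_fst c = 3 /\ exists t, X a1 t y /\ X a2 s t) \/
  (npair_fst c = 4 /\ exists t, X a1 (npair_snd s) (snth t 0) /\
     (forall k, k < npair_fst s ->
       X a2 (npair k (npair (snth t k) (npair_snd s))) (snth t k.+1)) /\
     y = snth t (npair_fst s)) \/
  (npair_fst c = 5 /\ X a (npair y s) 0 /\
     forall k, k < y -> exists z, X a (npair k s) z.+1) \/
  (npair_fst c = 6 /\ y = 0) \/
  (npair_fst c = 7 /\ X a1 s (npair_fst y) /\ X a2 s (npair_snd y)).

(** Passes between the readings of the premises that occur below: membership in a list,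
    derivability, and occurrence at a later position. *)
Lemma rule_mono X Y c s y : (forall c s y, X c s y -> Y c s y) ->
  rule X c s y -> rule Y c s y.
Proof.
move=> XY; rewrite /rule.
case=> [?|[?|[?|[[? [t [? ?]]]|[[? [t [? [h ?]]]]|[[? [? h]]|[?|[? [? ?]]]]]]]]].
- by left.
- by right; left.
- by do 2!right; left.
- by do 3!right; left; split=> //; exists t; split; exact: XY.
- do 4!right; left; split=> //; exists t; split; first exact: XY.
  by split=> // k kn; apply/XY/h.
- do 5!right; left; split=> //; split; first exact: XY.
  by move=> k /h[z ?]; exists z; exact: XY.
- by do 6!right; left.
- by do 7!right; split=> //; split; exact: XY.
Qed.

Definition judgment c s y : nat := npair c (npair s y).
Definition listed (l : seq nat) c s y : Prop := judgment c s y \in l.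

(** Conclusions stand before their premises: each entry follows by one rule from entries further on.
    Derivations can therefore simply be concatenated. *)
Fixpoint derivation (l : seq nat) : Prop :=
  if l is j :: l' then
    rule (listed l') (npair_fst j) (npair_fst (npair_snd j))
      (npair_snd (npair_snd j)) /\ derivation l'
  else True.

Lemma derivation_cat l l' :
  derivation l -> derivation l' -> derivation (l ++ l').
Proof.
elim: l => //= j l IHl [rj dl] dl'; split; last exact: IHl.
by apply: rule_mono rj => c s y; rewrite /listed mem_cat => ->.
Qed.

Definition derivable c s y : Prop :=
  exists2 l, derivation l & listed l c s y.

Lemma derivable_unfold c s y : derivable c s y -> rule derivable c s y.
Proof.
case=> l; elim: l => //= j l IHl [rj dl]; rewrite /listed inE => /orP[/eqP jE|].
  move: rj; rewrite -jE !npairE; apply: rule_mono => c' s' y' lj.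
  by exists l.
exact: IHl.
Qed.

(** Needed for the clauses of [Prec] and [Mu], whose number of premises is not bounded in
    advance. *)
Lemma derivable_all n (J : nat -> nat * nat * nat) :
  (forall k, k < n -> derivable (J k).1.1 (J k).1.2 (J k).2) ->
  exists2 l, derivation l &
    forall k, k < n -> listed l (J k).1.1 (J k).1.2 (J k).2.
Proof.
elim: n => [|n IHn] h; first by exists [::].
have [|l dl hl] := IHn; first by move=> k kn; apply/h/ltnW.
have [l' dl' hl'] := h n (ltnSn n).
exists (l ++ l') => [|k]; first exact: derivation_cat.
rewrite ltnS leq_eqVlt /listed mem_cat => /orP[/eqP->|/hl].
  by rewrite [_ \in l']hl' orbT.
by rewrite /listed => ->.
Qed.

Lemma derivable_cons l c s y :
  derivation l -> rule (listed l) c s y -> derivable c s y.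
Proof.
move=> dl r; exists (judgment c s y :: l); first by rewrite /= !npairE.
by rewrite /listed mem_head.
Qed.

Lemma derivable_fold c s y : rule derivable c s y -> derivable c s y.
Proof.
rewrite {1}/rule.
case=> [h|[h|[h|[[? [t [[l1 d1 h1] [l2 d2 h2]]]]|[[? [t [[l1 d1 h1] [h ?]]]]|
  [[? [[l1 d1 h1] h]]|[h|[? [[l1 d1 h1] [l2 d2 h2]]]]]]]]]].
- by apply: (@derivable_cons [::]) => //; left.
- by apply: (@derivable_cons [::]) => //; right; left.
- by apply: (@derivable_cons [::]) => //; do 2!right; left.
- apply: (@derivable_cons (l1 ++ l2)); first exact: derivation_cat.
  do 3!right; left; split=> //; exists t.
  by rewrite /listed !mem_cat; split; apply/orP; [left|right].
- have [l2 d2 h2] := @derivable_all _ (fun k =>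
    (npair_snd (npair_snd c), npair k (npair (snth t k) (npair_snd s)), snth t k.+1)) h.
  apply: (@derivable_cons (l1 ++ l2)); first exact: derivation_cat.
  do 4!right; left; split=> //; exists t.
  split; first by rewrite /listed mem_cat [_ \in l1]h1.
  by split=> // k kn; rewrite /listed mem_cat [_ \in l2]h2 // orbT.
- have /choice[z hz] : forall k, exists z, k < y ->
      derivable (npair_snd c) (npair k s) z.+1.
    move=> k; case: (boolP (k < y)) => [/h[z ?]|_]; last by exists 0.
    by exists z.
  have [l2 d2 h2] := @derivable_all y (fun k =>
    (npair_snd c, npair k s, (z k).+1)) hz.
  apply: (@derivable_cons (l1 ++ l2)); first exact: derivation_cat.
  do 5!right; left; split=> //.
  split; first by rewrite /listed mem_cat [_ \in l1]h1.
  by move=> k kn; exists (z k); rewrite /listed mem_cat [_ \in l2]h2 // orbT.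
- by apply: (@derivable_cons [::]) => //; do 6!right; left.
- apply: (@derivable_cons (l1 ++ l2)); first exact: derivation_cat.
  do 7!right; split=> //.
  by rewrite /listed !mem_cat; split; apply/orP; [left|right].
Qed.

End Derivations.

(** A list of programs is treated as one more program, whose value codes the list of values; all
    judgments then have the same form. *)
Definition code_list (cs : seq nat) : nat :=
  foldr (fun c r => npair 7 (npair c r)) (npair 6 0) cs.

Fixpoint murec_code (e : murec) : nat :=
  match e with
  | Zero => npair 0 0
  | Succ => npair 1 0
  | Proj i => npair 2 i
  | Comp f gs => npair 3 (npair (murec_code f) (code_list (map murec_code gs)))
  | Prec f g => npair 4 (npair (murec_code f) (murec_code g))
  | Mu f => npair 5 (murec_code f)
  end.

Lemma murec_codeE :
  (murec_code Zero = npair 0 0) * (murec_code Succ = npair 1 0) *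
  (forall i, murec_code (Proj i) = npair 2 i) *
  (forall f gs, murec_code (Comp f gs) =
     npair 3 (npair (murec_code f) (code_list (map murec_code gs)))) *
  (forall f g, murec_code (Prec f g) =
     npair 4 (npair (murec_code f) (murec_code g))) *
  (forall f, murec_code (Mu f) = npair 5 (murec_code f)).
Proof. by []. Qed.

Opaque murec_code.

Fixpoint murec_evals (gs : seq murec) (s t : seq nat) : Prop :=
  match gs, t with
  | [::], [::] => True
  | g :: gs', z :: t' => murec_eval g s z /\ murec_evals gs' s t'
  | _, _ => False
  end.

Lemma murec_eval_Comp f gs s y : murec_eval (Comp f gs) s y <->
  exists2 t, murec_evals gs s t & murec_eval f t y.
Proof.
have evalsE : forall gs t, (fix evals (gs : seq murec) (t : seq nat) : Prop :=
           match gs, t with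
           | [::], [::] => True
           | g :: gs', z :: t' => murec_eval g s z /\ evals gs' t'
           | _, _ => False
           end) gs t <-> murec_evals gs s t.
  by elim=> [|g gs' IH] [|z t'] //; split=> -[? /IH].
by split=> -[t /evalsE ? ?]; exists t => //; exact/evalsE.
Qed.

(** The [foldr] supplies the induction hypotheses for the inner programs of a composition, which the
    generated principle omits. *)
Lemma murec_ind_nested (P : murec -> Prop) :
  P Zero -> P Succ -> (forall i, P (Proj i)) ->
  (forall f gs, P f -> foldr (fun g Q => P g /\ Q) True gs -> P (Comp f gs)) ->
  (forall f g, P f -> P g -> P (Prec f g)) -> (forall f, P f -> P (Mu f)) ->
  forall e, P e.
Proof.
move=> hZ hS hP hC hR hM; fix IH 1 => -[||i|f gs|f g|f].
- exact: hZ.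
- exact: hS.
- exact: hP.
- by apply: hC => //; elim: gs => //= g gs' IHgs; split.
- exact: hR.
- exact: hM.
Qed.

(** As [npair] is not onto, a derivation may contain numbers that are not of the form [senc l].
    Soundness therefore compares entries only. *)
Definition agree (l : seq nat) (s : nat) := forall i, nth 0 l i = snth s i.

Lemma agree_cons l s x : agree l s -> agree (x :: l) (npair x s).
Proof.
by move=> ls [|i] /=; [rewrite snth0|rewrite snthS ls]; rewrite npairE.
Qed.

Lemma agree_behead l s : agree l s -> agree (behead l) (npair_snd s).
Proof. by move=> ls i; rewrite nth_behead ls snthS. Qed.

Lemma agree_head l s : agree l s -> head 0 l = npair_fst s.
Proof. by move=> ls; rewrite -nth0 ls. Qed.

(** The tag of the code leaves one clause of [rule]; the repeated case analyses discard the others.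
    For a composition, a genuine list [t'] is rebuilt from the number [t]. *)
Lemma derivable_sound e l s y :
  agree l s -> derivable (murec_code e) s y -> murec_eval e l y.
Proof.
elim/murec_ind_nested: e l s y => [||i|f gs IHf IHgs|f g IHf IHg|f IHf] l s y ls
  /derivable_unfold; rewrite /rule murec_codeE !npairE.
- case=> [[_ ->]|]; first by [].
  by do !(case=> [[//]|]); case.
- case=> [[//]|]; case=> [[_ ->]|]; first by rewrite /= (agree_head ls).
  by do !(case=> [[//]|]); case.
- do 2!(case=> [[//]|]); case=> [[_ ->]|]; first by rewrite /= ls.
  by do !(case=> [[//]|]); case.
- do 3!(case=> [[//]|]); case=> [[_ [t [ft gst]]]|]; last first.
    by do !(case=> [[//]|]); case.
  suff [t' t't gst'] : exists2 t', agree t' t & murec_evals gs l t'.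
    by apply/murec_eval_Comp; exists t' => //; apply: IHf ft.
  elim: gs t IHgs gst {ft} => [|g gs' IHgs'] t /=.
    move=> _ /derivable_unfold.
    rewrite /rule !npairE.
    do 6!(case=> [[//]|]).
    case=> [[_ ->]|[]//].
    by exists [::] => // i; rewrite nth_nil snth_0.
  move=> [IHg IHgs] /derivable_unfold; rewrite /rule !npairE.
  do 7!(case=> [[//]|]); case=> _ [gt /IHgs'[//|t' t't gst']].
  exists (npair_fst t :: t'); last by split=> //; exact: IHg gt.
  by case=> [|i] /=; rewrite ?snth0 // snthS t't.
- do 4!(case=> [[//]|]); case=> [[_ [t [ft [gt ->]]]]|]; last first.
    by do !(case=> [[//]|]); case.
  exists (snth t); rewrite (agree_head ls); split=> // [|k kn].
    by apply: IHf ft; exact: agree_behead.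
  by apply: IHg (gt k kn); do 2!apply: agree_cons; exact: agree_behead.
- do 5!(case=> [[//]|]); case=> [[_ [ft gt]]|]; last first.
    by do !(case=> [[//]|]); case.
  split; first by apply: IHf ft; exact: agree_cons.
  move=> k /gt[z fz]; exists z; apply: IHf fz; exact: agree_cons.
Qed.

Lemma senc_behead l : senc (behead l) = npair_snd (senc l).
Proof.
case: l => [|x l] /=; last by rewrite npair_sndK.
by apply/eqP; rewrite eq_sym -leqn0 npair_snd_leq.
Qed.

Lemma senc_head l : head 0 l = npair_fst (senc l).
Proof. by rewrite -nth0 -snth_senc. Qed.

Lemma derivable_complete e l y :
  murec_eval e l y -> derivable (murec_code e) (senc l) y.
Proof.
elim/murec_ind_nested: e l y => [||i|f gs IHf IHgs|f g IHf IHg|f IHf] l y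
  h; apply: derivable_fold; rewrite /rule murec_codeE !npairE.
- by left.
- by right; left; rewrite -senc_head.
- by do 2!right; left; rewrite snth_senc.
- have [t gst ft] := (murec_eval_Comp _ _ _ _).1 h.
  do 3!right; left; split=> //; exists (senc t).
  split; first exact: IHf.
  elim: gs t IHgs gst {ft h} => [|g gs' IHgs'] [|z t] //=.
    move=> _ _; apply: derivable_fold; rewrite /rule !npairE.
    by do 6!right; left.
  move=> [IHg IHgs] [gz gst].
  apply: derivable_fold; rewrite /rule !npairE; do 7!right.
  by split=> //; split; [exact: IHg|exact: IHgs'].
- case: h => t [ft gt ->]; do 4!right; left; split=> //.
  (* One entry more than there are recursion steps: the entry at [head 0 l] is the final value. *)
  exists (senc (mkseq t (head 0 l).+1)).
  rewrite -senc_head -senc_behead !snth_senc !nth_mkseq //.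
  split; first exact: IHf.
  split=> // k kn; rewrite !snth_senc !nth_mkseq // 1?ltnW//.
  exact: (IHg (k :: t k :: behead l)) (gt k kn).
- case: h => f0 fk; do 5!right; left; split=> //.
  split; first exact: (IHf (y :: l)).
  by move=> k /fk[z ?]; exists z; apply: (IHf (k :: l)).
Qed.

(** Replaces recursion on the list by quantifiers over positions, so that the list can become a
    number read by [snth]. *)
Lemma derivationP l : derivation l <-> forall i, i < size l ->
  let j := nth 0 l i in
  rule (fun c s y => exists k, i < k /\ k < size l /\
          nth 0 l k = judgment c s y)
    (npair_fst j) (npair_fst (npair_snd j)) (npair_snd (npair_snd j)).
Proof.
elim: l => [|j l IHl] //=; split=> [[rj /IHl dl] [|i] /=|h].
- move=> _; apply: rule_mono rj => c s y /(nthP 0)[k kl jE].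
  by exists k.+1.
- rewrite ltnS => /dl; apply: rule_mono => c s y [k [ik [kl jE]]].
  by exists k.+1.
- split.
    have := h 0 isT; apply: rule_mono => c s y [[|k] [//_ [kl jE]]].
    by rewrite /listed -jE; exact: mem_nth.
  apply/IHl => i il; have := h i.+1 il.
  apply: rule_mono => c s y [[|k] [// ik [kl jE]]].
  by exists k.
Qed.

Ltac sigma1_auto := repeat first
  [ match goal with
    | |- sigma1 (fun _ => ex _) => apply: sigma1_ex
    | |- sigma1 (fun _ => _ /\ _) => apply: sigma1_and
    | |- sigma1 (fun _ => _ \/ _) => apply: sigma1_or
    | |- sigma1 (fun _ => is_true (_ < _)) => apply: sigma1_lt
    | |- sigma1 (fun _ => _ = _) => apply: sigma1_eq
    | |- sigma1 (fun x => forall k, is_true (k < @?t x) -> _) =>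
      apply: (@sigma1_all _ t)
    end ].

(** [L] codes the derivation, [N] is its length, which the code does not record, and [m] is the
    position of the judgment. All universal quantifiers are bounded. *)
Lemma sigma1_derivable f g h : cf1 f -> cf1 g -> cf1 h ->
  sigma1 (fun x => derivable (f x) (g x) (h x)).
Proof.
move=> hf hg hh.
apply: (@sigma1_ext (fun x => exists L, exists N, exists m,
  (m < N /\ snth L m = judgment (f x) (g x) (h x)) /\
  forall i, i < N -> rule (fun c s y => exists k, i < k /\ k < N /\
          snth L k = judgment c s y)
    (npair_fst (snth L i)) (npair_fst (npair_snd (snth L i)))
    (npair_snd (npair_snd (snth L i))))) => [x|].
  split=> [[L [N [m [[mN jE] dL]]]]|[l dl /(nthP 0)[m ml jE]]].
    exists (mkseq (snth L) N); last first.
      by rewrite /listed -jE -(nth_mkseq 0 (snth L) mN) mem_nth ?size_mkseq.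
    apply/derivationP => i; rewrite size_mkseq => iN; rewrite /= nth_mkseq //.
    have := dL i iN; apply: rule_mono => c s y [k [ik [kN kE]]].
    by exists k; rewrite nth_mkseq.
  exists (senc l), (size l), m; rewrite snth_senc; split=> // i il.
  rewrite snth_senc; have := (derivationP l).1 dl i il.
  by apply: rule_mono => c s y [k [ik [kN kE]]]; exists k; rewrite snth_senc.
have hf' I (c : I -> seq nat) u : cf c u -> cf c (fun i => f (u i)).
  exact: cf_comp1.
have hg' I (c : I -> seq nat) u : cf c u -> cf c (fun i => g (u i)).
  exact: cf_comp1.
have hh' I (c : I -> seq nat) u : cf c u -> cf c (fun i => h (u i)).
  exact: cf_comp1.
rewrite /rule /judgment.
sigma1_auto.
all: do !first [progress cf_all | apply: hf' | apply: hg' | apply: hh'].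
Qed.

Definition diagonal (n : nat) : Prop := exists y, derivable n (senc [:: n]) y.

Lemma sigma1_diagonal : sigma1 diagonal.
Proof.
apply: (@sigma1_ex (fun y n => derivable n (senc [:: n]) y)).
by apply: sigma1_derivable; rewrite /senc /=; cf_all.
Qed.

Lemma co_diagonal_not_ce :
  ~ exists e, forall n, ~ diagonal n <-> halts e [:: n].
Proof.
move=> [e he]; have := he (murec_code e).
suff -> : halts e [:: murec_code e] <-> diagonal (murec_code e) by tauto.
split=> -[y ey]; exists y; first exact: derivable_complete ey.
by apply: derivable_sound ey => i; rewrite snth_senc.
Qed.

Lemma murec_eval_functional e l y y' :
  murec_eval e l y -> murec_eval e l y' -> y = y'.
Proof.
elim/murec_ind_nested: e l y y' => [||i|f gs IHf IHgs|f g IHf IHg|f IHf] l y y'.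
- by move=> -> ->.
- by move=> -> ->.
- by move=> -> ->.
- move=> /murec_eval_Comp[t gst ft] /murec_eval_Comp[t' gst' ft'].
  suff tt' : t = t' by apply: IHf ft _; rewrite tt'.
  elim: gs t t' IHgs gst gst' {ft ft'} => [|g gs IH] [|z t] [|z' t'] //=.
  by move=> [IHg IHgs] [/IHg gz /IH{}IH] [/gz-> /IH->].
- move=> [t [ft gt ->]] [t' [ft' gt' ->]].
  suff tt' k : k <= head 0 l -> t k = t' k by exact: tt'.
  elim: k => [_|k IHk kl]; first exact: IHf ft ft'.
  apply: IHg (gt k kl) _; rewrite IHk; last exact: ltnW.
  exact: gt'.
- move=> [fy hy] [fy' hy']; case: (ltngtP y y') => // [/hy'|/hy] [z fz].
    by have := IHf _ _ _ fy fz.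
  by have := IHf _ _ _ fy' fz.
Qed.

Lemma ce_search (I : Type) (c : I -> seq nat) (A : I -> Prop) f
    (Q : nat -> bool) : cf c f -> cf1 (fun x => nat_of_bool (Q x)) ->
  (forall i, A i <-> exists k, Q (npair k (f i))) ->
  exists e, forall i, A i <-> halts e (c i).
Proof.
move=> [ef hf] hQ AQ.
(* The test is negated because [Mu] searches for the value 0. *)
have [eb hb] : cf2 (fun k x => nat_of_bool (~~ Q (npair k x))).
  by cf_all; apply: (@cf_comp1 _ _ (fun x => nat_of_bool (Q x))) => //; cf_all.
exists (Comp (Mu eb) [:: ef]) => i; rewrite AQ; split=> [Qk|[y]].
  exists (ex_minn Qk); case: ex_minnP => k Qki kmin.
  exists [:: f i]; first by split.
  split; first by have := hb (k, f i); rewrite /= Qki.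
  move=> k' k'k; exists 0; have := hb (k', f i); rewrite /=.
  by case: (boolP (Q _)) => // /kmin; rewrite leqNgt k'k.
move=> [[|z [|? ?]] /= [] // fz _ [by0 _]]; exists y.
rewrite -(murec_eval_functional fz (hf i)).
have := murec_eval_functional by0 (hb (y, z)).
by rewrite /=; case: (Q _).
Qed.

(** * The rational points *)

(** Sylvester's sequence [2, 3, 7, 43, ...] *)
Fixpoint sylvester_prod (n : nat) : nat :=
  if n is m.+1 then sylvester_prod m * (sylvester_prod m).+1 else 1.

Definition sylvester (n : nat) : nat := (sylvester_prod n).+1.

Lemma sylvester_prod_gt0 n : 0 < sylvester_prod n.
Proof. by elim: n => //= n IHn; rewrite muln_gt0 IHn. Qed.

Lemma sylvester_gt1 n : 1 < sylvester n.
Proof. by rewrite ltnS sylvester_prod_gt0. Qed.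

Lemma sylvester_gt0 n : 0 < sylvester n.
Proof. by []. Qed.

Lemma sylvester_dvdn m n : m < n -> sylvester m %| sylvester_prod n.
Proof.
elim: n => //= n IHn; rewrite ltnS leq_eqVlt => /orP[/eqP->|/IHn mn].
  exact: dvdn_mull.
exact: dvdn_mulr.
Qed.

Lemma sylvester_prod_coprime n : coprime (sylvester_prod n) (sylvester n).
Proof. exact: coprimenS. Qed.

(** The earlier term divides the product whose successor is the later term. *)
Lemma sylvester_coprime m n : m != n -> coprime (sylvester m) (sylvester n).
Proof.
wlog mn : m n / m < n => [hw|_].
  move=> mn; case: (ltngtP m n) => [lt|lt|e]; first exact: hw.
    by rewrite coprime_sym hw // eq_sym.
  by rewrite e eqxx in mn.
exact: coprime_dvdl (sylvester_dvdn mn) (sylvester_prod_coprime n).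
Qed.

(** A solution is corrected for [N] without changing it modulo [sylvester_prod N], hence modulo
    every earlier term. *)
Lemma sylvester_chinese (r : nat -> nat) N :
  exists m, forall n, n < N -> m = r n %[mod sylvester n].
Proof.
elim: N => [|N [m hm]]; first by exists 0.
exists (chinese (sylvester_prod N) (sylvester N) m (r N)) => n.
rewrite ltnS leq_eqVlt => /orP[/eqP->|nN].
  by rewrite chinese_modr // sylvester_prod_coprime.
rewrite -(hm n nN).
have := chinese_modl (sylvester_prod_coprime N) m (r N).
move=> /(congr1 (fun x => x %% sylvester n)).
by rewrite !modn_dvdm ?sylvester_dvdn.
Qed.

Lemma cf_sylvester I (c : I -> seq nat) f :
  cf c f -> cf c (fun i => sylvester (f i)).
Proof.
move=> hf; apply: cf_succ.
apply: (@cf_comp2 _ _ (fun n _ => sylvester_prod n) f f) => //.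
apply: (@cf_rec (fun n _ => sylvester_prod n) (fun=> 1)
  (fun _ a _ => a * a.+1)) => //; cf.
by cf_all.
Qed.

Section RationalPoints.
Variable Q : nat -> bool.
Hypothesis hQ : cf1 (fun x => nat_of_bool (Q x)).

(** The number [i = <b, <a, c>>] codes the real sequence [v] with
    [v 0 = a / (b + 1)] and, if [c] codes the sequence of the pairs
    [<w n, u n>], [v n.+1 = u n / (b + 1)] if [Q <w n, n>] holds and
    [v n.+1 = v 0 / sylvester n] otherwise. *)
Definition flagged (i n : nat) : bool :=
  Q (npair (npair_fst (snth (npair_snd (npair_snd i)) n)) n).

Definition pt_num (i n : nat) : nat :=
  if n == 0 then npair_fst (npair_snd i)
  else if flagged i n.-1 then npair_snd (snth (npair_snd (npair_snd i)) n.-1)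
  else npair_fst (npair_snd i).

Definition pt_den (i n : nat) : nat :=
  if n == 0 then (npair_fst i).+1
  else if flagged i n.-1 then (npair_fst i).+1
  else (npair_fst i).+1 * sylvester n.-1.

Lemma pt_den_gt0 i n : 0 < pt_den i n.
Proof. by rewrite /pt_den; case: ifP => // _; case: ifP. Qed.

(** Makes 0 an index of the neutral element, whatever [Q] is, because both projections of 0 are
    0. *)
Lemma pt_num0 n : pt_num 0 n = 0.
Proof.
have u1 : npair_fst 0 = 0 by apply/eqP; rewrite -leqn0 npair_fst_leq.
have u2 : npair_snd 0 = 0 by apply/eqP; rewrite -leqn0 npair_snd_leq.
by rewrite /pt_num !(u1, u2) snth_0 u2; case: ifP => // _; case: ifP.
Qed.

(** The bound is uniform in [n]; it makes the one-parameter subgroup through the point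
    continuous. *)
Lemma pt_num_leq i n : pt_num i n <= i.
Proof.
have u12 : npair_fst (npair_snd i) <= i.
  exact: leq_trans (npair_fst_leq _) (npair_snd_leq _).
rewrite /pt_num; case: ifP => // _; case: ifP => // _.
apply: leq_trans (npair_snd_leq _) _; apply: leq_trans (snth_leq _ _) _.
exact: leq_trans (npair_snd_leq _) (npair_snd_leq _).
Qed.

Section Closure.
Variables (I : Type) (c : I -> seq nat) (f g : I -> nat).
Hypotheses (hf : cf c f) (hg : cf c g).

Lemma cf_flagged : cf c (fun i => nat_of_bool (flagged (f i) (g i).-1)).
Proof.
apply: (@cf_comp1 _ _ (fun x => nat_of_bool (Q x))) => //.
by cf_all; exact: cf_pred.
Qed.

Lemma cf_pt_num : cf c (fun i => pt_num (f i) (g i)).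
Proof.
by rewrite /pt_num; cf_all; first [exact: cf_flagged|exact: cf_pred].
Qed.

Lemma cf_pt_den : cf c (fun i => pt_den (f i) (g i)).
Proof.
rewrite /pt_den; cf_all; first exact: cf_flagged.
by apply: cf_sylvester; exact: cf_pred.
Qed.

End Closure.

Definition sum_den (i j l n : nat) : nat :=
  pt_den i n * pt_den j n * pt_den l n.
Definition sum_num (i j l n : nat) : nat :=
  (pt_num i n * pt_den j n + pt_num j n * pt_den i n) * pt_den l n.
Definition sub_num (i j l n : nat) : nat :=
  pt_num l n * (pt_den i n * pt_den j n).
Definition absdiff (a b : nat) : nat := (a - b) + (b - a).
(** For the sequences [v], [v'], [v''] coded by [i], [j], [l], this is the
    numerator over [sum_den] of the distance from [v n + v' n - v'' n] to the
    nearest integer. *)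
Definition gap (i j l n : nat) : nat :=
  let D := sum_den i j l n in
  let r := absdiff (sum_num i j l n) (sub_num i j l n) %% D in
  if r <= D - r then r else D - r.

(** The distance from the sum of points [i] and [j] to point [l], in units of [2^-k]. Each term of
    the supremum is rounded down, and the terms beyond [k] are below one unit, so the total error is
    at most one unit. *)
Definition approx_dist (i j l k : nat) : nat :=
  \max_(n < k.+1) (gap i j l n * 2 ^ k %/ (sum_den i j l n * 2 ^ n)).

Lemma cf_bigmax I (c : I -> seq nat) (F : nat -> nat -> nat) f g :
  cf2 F -> cf c f -> cf c g -> cf c (fun i => \max_(n < (f i).+1) F n (g i)).
Proof.
move=> hF; apply: (@cf_comp2 _ _ (fun n x => \max_(n < n.+1) F n x)).
apply: (@cf_rec (fun n x => \max_(n < n.+1) F n x) (F 0)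
  (fun n a x => a + (F n.+1 x - a))) => [x|n x||].
- by rewrite big_ord_recl big_ord0 maxn0.
- by rewrite big_ord_recr /= maxnE.
- by apply: (@cf_comp2 _ _ F) => //; cf.
- by cf_all; apply: (@cf_comp2 _ _ F) => //; cf_all.
Qed.

Section Closure4.
Variables (I : Type) (c : I -> seq nat) (fi fj fl fk : I -> nat).
Hypotheses (hi : cf c fi) (hj : cf c fj) (hl : cf c fl) (hk : cf c fk).

Lemma cf_sum_den : cf c (fun x => sum_den (fi x) (fj x) (fl x) (fk x)).
Proof. by rewrite /sum_den; cf_all; apply: cf_pt_den. Qed.

Lemma cf_gap : cf c (fun x => gap (fi x) (fj x) (fl x) (fk x)).
Proof.
rewrite /gap /absdiff /sum_num /sub_num.
cf_all; first [exact: cf_sum_den|exact: cf_pt_den|exact: cf_pt_num].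
Qed.

End Closure4.

Lemma cf_approx_dist I (c : I -> seq nat) fi fj fl fk :
  cf c fi -> cf c fj -> cf c fl -> cf c fk ->
  cf c (fun x => approx_dist (fi x) (fj x) (fl x) (fk x)).
Proof.
move=> hi hj hl hk.
pose F n z := gap (npair_fst z) (npair_fst (npair_snd z))
    (npair_fst (npair_snd (npair_snd z))) n * 2 ^ npair_snd (npair_snd (npair_snd z)) %/
  (sum_den (npair_fst z) (npair_fst (npair_snd z)) (npair_fst (npair_snd (npair_snd z))) n
   * 2 ^ n).
apply: (@cf_ext _ _ (fun x => \max_(n < (fk x).+1)
    F n (npair (fi x) (npair (fj x) (npair (fl x) (fk x)))))) => [x|].
  by apply: eq_bigr => n _; rewrite /F !npairE.
apply: cf_bigmax => //; last by cf_all.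
by rewrite /F; cf_all; first [apply: cf_gap|apply: cf_sum_den]; cf_all.
Qed.

End RationalPoints.

Import Order.TTheory GRing.Theory Num.Theory.
Import numFieldTopology.Exports.
Local Open Scope classical_set_scope.
Local Open Scope ring_scope.

(** * The norm of the circle *)

Section CircleNorm.
Variable R : realType.
Implicit Types (x y : R) (z w : circle R).

Definition int_dist x : R :=
  Num.min (x - (Num.floor x)%:~R) ((Num.floor x)%:~R + 1 - x).

(** Together with [int_dist_ex] this characterises [int_dist] as a minimum over the integers, from
    which the triangle inequality, symmetry and periodicity follow without the floor. *)
Lemma int_dist_le x (m : int) : int_dist x <= `|x - m%:~R|.
Proof.
have /andP[f1 f2] := floor_itv x; rewrite intrD in f2.
rewrite /int_dist ge_min; case: (leP m (Num.floor x)) => mf; apply/orP.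
  left; rewrite ger0_norm ?lerD2l ?lerN2 ?ler_int // subr_ge0.
  by apply: le_trans f1; rewrite ler_int.
have : (Num.floor x)%:~R + 1 <= m%:~R :> R.
  by rewrite -[1]/(1%:~R) -intrD ler_int -ltzD1 ltrD2r.
right; rewrite distrC ger0_norm ?lerD2r // subr_ge0.
exact/ltW/(lt_le_trans f2).
Qed.

Lemma int_dist_ex x : exists m : int, int_dist x = `|x - m%:~R|.
Proof.
have /andP[f1 f2] := floor_itv x; rewrite intrD in f2.
rewrite /int_dist minEle; case: ifP => _.
  by exists (Num.floor x); rewrite ger0_norm // subr_ge0.
exists (Num.floor x + 1); rewrite distrC intrD ger0_norm // subr_ge0.
exact: ltW.
Qed.

Lemma int_dist_ge0 x : 0 <= int_dist x.
Proof. by have [m ->] := int_dist_ex x; rewrite normr_ge0. Qed.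

Lemma int_dist_le_abs x : int_dist x <= `|x|.
Proof. by have := int_dist_le x 0; rewrite subr0. Qed.

Lemma int_dist_le1 x : int_dist x <= 1.
Proof.
rewrite /int_dist ge_min; apply/orP; right.
by rewrite lerBlDr addrC lerD2l floor_le.
Qed.

Lemma int_dist_triangle x y : int_dist (x + y) <= int_dist x + int_dist y.
Proof.
have [m ->] := int_dist_ex x; have [n ->] := int_dist_ex y.
apply: le_trans (int_dist_le _ (m + n)) _.
by rewrite intrD opprD addrACA ler_normD.
Qed.

Lemma int_distN x : int_dist (- x) = int_dist x.
Proof.
suff le_N y : int_dist (- y) <= int_dist y.
  by apply/le_anti; rewrite le_N /= -{1}[x]opprK le_N.
have [m ->] := int_dist_ex y; apply: le_trans (int_dist_le _ (- m)) _.
by rewrite intrN -opprD normrN.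
Qed.

Lemma int_distDint x (m : int) : int_dist (x + m%:~R) = int_dist x.
Proof.
suff le_D y (n : int) : int_dist (y + n%:~R) <= int_dist y.
  by apply/le_anti; rewrite le_D -{1}[x](addrK m%:~R) -intrN le_D.
have [k ->] := int_dist_ex y; apply: le_trans (int_dist_le _ (k + n)) _.
by rewrite intrD opprD addrACA subrr addr0.
Qed.

Lemma int_dist_eq0 x : int_dist x = 0 -> x \is a Num.int.
Proof.
have [m ->] := int_dist_ex x => /normr0_eq0/eqP.
by rewrite subr_eq0 => /eqP->; exact: intr_int.
Qed.

Definition cnorm z : R := int_dist (repr (z : Quotient.quot (@int_pred R))).

Lemma cnormE x : cnorm (to_circle x) = int_dist x.
Proof.
rewrite /cnorm; set y := repr _.
have yx : to_circle y = to_circle x by rewrite /to_circle reprK.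
have /to_circle_eq/intrP[m yxm] := yx.
by rewrite -[y](subrK x) yxm addrC int_distDint.
Qed.

Lemma to_circleD x y : to_circle (x + y) = to_circle x + to_circle y.
Proof. by rewrite /to_circle raddfD. Qed.
Lemma to_circleN x : to_circle (- x) = - to_circle x.
Proof. by rewrite /to_circle raddfN. Qed.
Lemma to_circle0 : to_circle (0 : R) = 0.
Proof. by rewrite /to_circle raddf0. Qed.
Lemma to_circleMn x n : to_circle (x *+ n) = to_circle x *+ n.
Proof.
by elim: n => [|n IHn]; rewrite ?mulr0n ?to_circle0 // !mulrS to_circleD IHn.
Qed.
Lemma to_circle_nat (n : nat) : to_circle (n%:R : R) = 0.
Proof.
rewrite -to_circle0; apply/to_circle_eq; rewrite subr0.
by rewrite pmulrn; exact: intr_int.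
Qed.

Lemma cnorm_ge0 z : 0 <= cnorm z. Proof. exact: int_dist_ge0. Qed.
Lemma cnorm_le1 z : cnorm z <= 1. Proof. exact: int_dist_le1. Qed.

Lemma cnorm0 : cnorm 0 = 0.
Proof.
apply/le_anti; rewrite cnorm_ge0 andbT -to_circle0 cnormE.
by rewrite (le_trans (int_dist_le_abs _)) ?normr0.
Qed.

Lemma cnorm_triangle z w : cnorm (z + w) <= cnorm z + cnorm w.
Proof.
have [x <-] := to_circle_surj z; have [y <-] := to_circle_surj w.
by rewrite -to_circleD !cnormE int_dist_triangle.
Qed.

Lemma cnormN z : cnorm (- z) = cnorm z.
Proof.
by have [x <-] := to_circle_surj z; rewrite -to_circleN !cnormE int_distN.
Qed.

Lemma cnorm_eq0 z : cnorm z = 0 -> z = 0.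
Proof.
have [x <-] := to_circle_surj z; rewrite cnormE => /int_dist_eq0 xZ.
by rewrite -to_circle0; apply/to_circle_eq; rewrite subr0.
Qed.

(** Let [m] be nearest to [x] and [n] to [2x]. If [n] differs from [2m], their distance is at least
    1, so [2x] has norm at least 1 minus twice that of [x]; below [1/4] this exceeds twice the norm
    of [x], against the triangle inequality. *)
Lemma cnorm_mul2 z : cnorm z < 4^-1 -> cnorm (z *+ 2) = cnorm z *+ 2.
Proof.
have [x <-] := to_circle_surj z; rewrite -to_circleMn !cnormE => xlt.
have [m xm] := int_dist_ex x; have [n xn] := int_dist_ex (x *+ 2).
apply/le_anti; rewrite {1}mulr2n {1}mulr2n int_dist_triangle /=.
have [nm|nm] := eqVneq n (m *+ 2).
  by rewrite xn nm xm -normrMn mulrnBl rmorphMn.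
have : 1 <= `|(n - m *+ 2)%:~R| :> R.
  rewrite -intr_norm -[1]/(1%:~R) ler_int.
  by rewrite -gtz0_ge1 normr_gt0 subr_eq0.
have -> : (n - m *+ 2)%:~R = (x - m%:~R) *+ 2 - (x *+ 2 - n%:~R) :> R.
  by rewrite intrB rmorphMn /=; ring.
move=> /le_trans/(_ (ler_normB _ _)); rewrite -xn normrMn -xm !mulr2n.
by move: xlt; lra.
Qed.

(** Repeated doubling would double a nonzero norm until it leaves the ball of radius [1/4]. *)
Lemma no_small_subgroup z : (forall n, cnorm (z *+ n) < 4^-1) -> z = 0.
Proof.
move=> zn; apply: cnorm_eq0; apply/eqP; rewrite eq_le cnorm_ge0 andbT leNgt.
apply/negP => z0.
have zk k : cnorm (z *+ (2 ^ k)) = cnorm z *+ (2 ^ k).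
  elim: k => [|k IHk]; first by rewrite expn0 !mulr1n.
  by rewrite expnS mulnC !mulrnA cnorm_mul2 // IHk.
have [k kz] : exists k : nat, (cnorm z)^-1 < k%:R.
  by exists (Num.truncn (cnorm z)^-1).+1; exact: truncnS_gt.
have := zn (2 ^ k)%N; rewrite zk ltNge => /negP; apply.
rewrite -[cnorm z *+ _]mulr_natr; apply: (@le_trans _ _ 1); first by lra.
rewrite mulrC -ler_pdivrMr // mul1r (le_trans (ltW kz)) // ler_nat.
exact/ltnW/ltn_expl.
Qed.

Lemma cnorm_open z r : open [set w | cnorm (w - z) < r].
Proof.
have [x <-] := to_circle_surj z.
have -> : [set w | cnorm (w - to_circle x) < r] =
    (to_circle (R:=R)) @` (\bigcup_(m : int) [set y | `|y - x - m%:~R| < r]).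
  apply/seteqP; split=> [w|_ [y [m _ ym]] <-].
    have [y <-] /= := to_circle_surj w; rewrite -to_circleB cnormE => yx.
    exists y => //; have [m ym] := int_dist_ex (y - x).
    by exists m => //=; rewrite -ym.
  rewrite /= -to_circleB cnormE; exact: le_lt_trans (int_dist_le _ _) ym.
apply: to_circle_open; apply: bigcup_open => m _.
have -> : [set y | `|y - x - m%:~R| < r] = ball (x + m%:~R) r.
  by apply/seteqP; split=> y; rewrite /ball /= (distrC (x + _)) opprD addrA.
exact: ball_open.
Qed.

Lemma circle_nbhsP z (W : set (circle R)) :
  nbhs z W <-> exists2 r, 0 < r & forall w, cnorm (w - z) < r -> W w.
Proof.
split=> [|[r r0 zW]]; last first.
  apply: filterS zW _; apply: open_nbhs_nbhs; split; first exact: cnorm_open.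
  by rewrite /= subrr cnorm0.
have [x <-] := to_circle_surj z => /to_circle_continuous.
move=> /nbhs_ballP[r /= r0 xW]; exists r => // w.
have [y <-] := to_circle_surj w; rewrite -to_circleB cnormE => yx.
have [m ym] := int_dist_ex (y - x); rewrite ym in yx.
have <- : to_circle (y - m%:~R) = to_circle y.
  by apply/to_circle_eq; rewrite addrAC subrr add0r -intrN; exact: intr_int.
by apply: xW; rewrite /ball /= distrC addrAC.
Qed.

End CircleNorm.

(** * The group and its metric *)

Section Solenoid.
Variables (R : realType) (S : set nat).

Definition solenoid_pred : {pred nat -> circle R} :=
  fun z => `[< forall n, S n -> z n.+1 *+ sylvester n = z 0%N >].

Lemma solenoid_zmod_closed : zmod_closed solenoid_pred.
Proof.
split=> [|z w /asboolP zS /asboolP wS]; apply/asboolP => n Sn.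
  by rewrite /= mul0rn.
by rewrite !fctE mulrnBl zS // wS.
Qed.

HB.instance Definition _ := GRing.isZmodClosed.Build (nat -> circle R)
  solenoid_pred solenoid_zmod_closed.

Record solenoid : Type :=
  Solenoid { sol_fun :> nat -> circle R; _ : sol_fun \in solenoid_pred }.

HB.instance Definition _ := [isSub for sol_fun].
HB.instance Definition _ := [Choice of solenoid by <:].
HB.instance Definition _ := [SubChoice_isSubZmodule of solenoid by <:].

Implicit Types z w : solenoid.

Lemma solenoid_relation z n : S n -> z n.+1 *+ sylvester n = z 0%N.
Proof. by case: z => z zS /=; move/asboolP: zS; apply. Qed.

Lemma solenoid_eqP z w : z =1 w -> z = w.
Proof. by move=> zw; apply/val_inj/funext. Qed.

Lemma solenoidB z w n : (z - w) n = z n - w n. Proof. by []. Qed.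
Lemma solenoidD z w n : (z + w) n = z n + w n. Proof. by []. Qed.
Lemma solenoidN z n : (- z) n = - z n. Proof. by []. Qed.
Lemma solenoid0 n : (0 : solenoid) n = 0. Proof. by []. Qed.
Lemma solenoidMn z k n : (z *+ k) n = z n *+ k.
Proof. by elim: k => [|k IHk]; rewrite ?mulr0n // !mulrS solenoidD IHk. Qed.

(** With a supremum in place of a sum, rounding errors of the coordinates do not accumulate. *)
Definition sdist z w : R := sup (range (fun n => 2 ^- n * cnorm (z n - w n))).

Lemma sdist_term_le1 z w n : 2 ^- n * cnorm (z n - w n) <= 1.
Proof.
rewrite -[leRHS]mulr1 ler_pM ?invr_ge0 ?exprn_ge0 ?cnorm_ge0 ?cnorm_le1 //.
by rewrite invf_le1 ?exprn_gt0 // exprn_ege1 // ler1n.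
Qed.

Lemma sdist_le z w e :
  sdist z w <= e <-> forall n, 2 ^- n * cnorm (z n - w n) <= e.
Proof.
split=> [h n|h]; last first.
  apply: ge_sup; first by exists (2 ^- 0 * cnorm (z 0%N - w 0%N)); exists 0%N.
  by move=> _ [n _ <-].
apply: le_trans h; apply: ub_le_sup; last by exists n.
by exists 1 => _ [m _ <-]; exact: sdist_term_le1.
Qed.

Lemma sdist_term z w n : 2 ^- n * cnorm (z n - w n) <= sdist z w.
Proof. by have /sdist_le := lexx (sdist z w). Qed.

Lemma sdist_coord z w n : cnorm (z n - w n) <= 2 ^+ n * sdist z w.
Proof.
have := sdist_term z w n.
by rewrite mulrC ler_pdivrMr ?exprn_gt0 // mulrC.
Qed.

Lemma sdist_ge0 z w : 0 <= sdist z w.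
Proof.
apply: le_trans (sdist_term z w 0).
by rewrite mulr_ge0 ?cnorm_ge0 // invr_ge0 exprn_ge0.
Qed.

Lemma sdistxx z : sdist z z = 0.
Proof.
apply/le_anti; rewrite sdist_ge0 andbT.
by apply/sdist_le => n; rewrite subrr cnorm0 mulr0.
Qed.

Lemma sdist_positivity z w : sdist z w = 0 -> z = w.
Proof.
move=> zw0; apply: solenoid_eqP => n; apply/eqP; rewrite -subr_eq0; apply/eqP.
apply: cnorm_eq0; apply/le_anti; rewrite cnorm_ge0 andbT.
by have := sdist_coord z w n; rewrite zw0 mulr0.
Qed.

Lemma sdist_sym z w : sdist z w = sdist w z.
Proof.
by congr sup; apply: eq_imagel => n _; rewrite -cnormN opprB.
Qed.

Lemma sdist_triangle w z t : sdist z t <= sdist z w + sdist w t.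
Proof.
apply/sdist_le => n.
apply: le_trans (lerD (sdist_term z w n) (sdist_term w t n)).
rewrite -mulrDr ler_wpM2l ?invr_ge0 ?exprn_ge0 //.
by rewrite -{1}[z n](subrK (w n)) -addrA cnorm_triangle.
Qed.

HB.instance Definition _ :=
  isMetric.Build R solenoid sdistxx sdist_positivity sdist_sym sdist_triangle.

Lemma sdistBB z w t u : sdist (z - w) (t - u) <= sdist z t + sdist w u.
Proof.
apply/sdist_le => n.
apply: le_trans (lerD (sdist_term z t n) (sdist_term w u n)).
rewrite -mulrDr ler_wpM2l ?invr_ge0 ?exprn_ge0 //.
have -> : (z - w) n - (t - u) n = (z n - t n) - (w n - u n).
  by rewrite !solenoidB !opprD !opprK addrACA.
by rewrite -(cnormN (w n - u n)) cnorm_triangle.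
Qed.

Lemma sdist_opp z w : sdist (- z) (- w) = sdist z w.
Proof.
by congr sup; apply: eq_imagel => n _; rewrite !solenoidN -opprD cnormN.
Qed.

Lemma sdistDD z w t u : sdist (z + w) (t + u) <= sdist z t + sdist w u.
Proof.
by have := sdistBB z (- w) t (- u); rewrite !opprK sdist_opp.
Qed.

Lemma sdist_shift z w t : sdist (z - w) t = sdist z (t + w).
Proof.
congr sup; apply: eq_imagel => n _.
by rewrite solenoidB solenoidD opprD addrAC addrA.
Qed.

Lemma ball_sdist z e : ball z e = [set w | sdist z w < e].
Proof. by rewrite ballEmdist. Qed.

Lemma solenoid_sub_continuous :
  continuous (fun p : solenoid * solenoid => p.1 - p.2).
Proof.
move=> [z w] W /nbhs_ballP[e /= e0 eW].
exists (ball z (e / 2), ball w (e / 2)) => /=.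
  by split; apply: nbhsx_ballx; rewrite divr_gt0.
move=> [t u] [/=]; rewrite !ball_sdist /= => zt wu; apply: eW.
rewrite ball_sdist /= (le_lt_trans (sdistBB _ _ _ _)) //.
by rewrite [e]splitr ltrD.
Qed.

HB.instance Definition _ :=
  PreTopologicalNmodule_isTopologicalZmodule.Build solenoid
    solenoid_sub_continuous.

Lemma solenoid_coord_continuous n : continuous (fun z => z n : circle R).
Proof.
move=> z W /circle_nbhsP[r r0 rW]; apply/nbhs_ballP.
exists (2 ^- n * r); first by rewrite /= mulr_gt0 ?invr_gt0 ?exprn_gt0.
move=> w; rewrite ball_sdist /= => zw; apply: rW.
rewrite -cnormN opprB; apply: le_lt_trans (sdist_coord _ _ _) _.
by rewrite -ltr_pdivlMl ?exprn_gt0.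
Qed.

Lemma sdist_lt_eps z w (e : R) (N : nat) : 0 < e -> 2 ^- N < e ->
  (forall n, (n < N)%N -> cnorm (z n - w n) < e) -> sdist z w <= e.
Proof.
move=> e0 Ne zw; apply/sdist_le => n; case: (ltnP n N) => [/zw lt_e|Nn].
  apply: le_trans (ltW lt_e); rewrite ler_piMl ?cnorm_ge0 //.
  by rewrite invf_le1 ?exprn_gt0 // exprn_ege1 // ler1n.
apply: le_trans (ltW Ne); rewrite -[leRHS]mulr1 ler_pM ?invr_ge0 ?exprn_ge0 //.
- exact: cnorm_ge0.
- by rewrite lef_pV2 ?posrE ?exprn_gt0 // ler_weXn2l // ler1n.
- exact: cnorm_le1.
Qed.

Lemma exp2_small (e : R) : 0 < e -> exists N, 2 ^- N < e.
Proof.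
move=> e0; exists (Num.truncn e^-1).+1.
rewrite -[ltRHS]invrK ltf_pV2 ?posrE ?exprn_gt0 ?invr_gt0 //.
apply: lt_trans (truncnS_gt _) _.
by rewrite -natrX ltr_nat ltn_expl.
Qed.

(** A choice [s] of representatives in [[0, 1]] pushes the filter to a cube, compact by Tychonoff,
    and a cluster point [f] there projects to one of [F]. The choice need not be continuous; only
    the projection back to the circles must be. *)
Lemma solenoid_compact : compact [set: solenoid].
Proof.
move=> F FF _.
have rep_ex (z : solenoid) :
    exists f : nat -> R, forall n, 0 <= f n <= 1 /\ to_circle (f n) = z n.
  suff /choice[f hf] : forall n, exists x : R, 0 <= x <= 1 /\ to_circle x = z n.
    by exists f.
  move=> n; have [x <-] := to_circle_surj (z n).
  exists (x - (Num.floor x)%:~R); split; last first.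
    by apply/to_circle_eq; rewrite addrAC subrr add0r -intrN; exact: intr_int.
  have /andP[f1 f2] := floor_itv x; rewrite intrD in f2.
  by rewrite subr_ge0 f1 lerBlDl ltW.
have {rep_ex}/choice[s hs] := rep_ex.
pose T := prod_topology (fun _ : nat => R).
have cube : compact [set f : T | forall n, `[0, 1]%classic (f n)].
  apply: (@tychonoff nat (fun=> R) (fun=> `[0, 1]%classic)) => n.
  exact: segment_compact.
have [|f [f01 fcl]] := cube _ (fmap_proper_filter (s : solenoid -> T) FF).
  apply: (@filterE _ F _) => z n /=.
  by rewrite in_itv /=; have [] := hs z n.
have near_f N e : 0 < e -> nbhs (f : T) [set g : T | forall n, (n < N)%N ->
    `|f n - g n| < e].
  move=> e0; elim: N => [|N IHN]; first exact: filterS filterT.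
  have near_N : nbhs (f : T) [set g : T | `|f N - g N| < e].
    apply: (@proj_continuous nat (fun=> R) N f [set x | `|f N - x| < e]).
    exact: (@nbhsx_ballx R R (f N) e e0).
  apply: filterS (filterI IHN near_N) => g /= [IH fgN] n.
  by rewrite ltnS leq_eqVlt => /orP[/eqP->|/IH].
have close A N e : F A -> 0 < e -> exists2 z : solenoid, A z &
    forall n, (n < N)%N -> cnorm (to_circle (f n) - z n) < e.
  move=> FA e0; have sFA : F ((s : solenoid -> T) @^-1` (s @` A)).
    by apply: filterS FA => z Az; exists z.
  have [_ [[z Az <-] /= fz]] := fcl _ _ sFA (near_f N e e0).
  exists z => // n /fz fzn; have [_ <-] := hs z n.
  by rewrite -to_circleB cnormE (le_lt_trans (int_dist_le_abs _)).
have fS : (fun n => to_circle (f n)) \in solenoid_pred.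
  apply/asboolP => n Sn; apply/eqP; rewrite -subr_eq0; apply/eqP.
  apply: cnorm_eq0; apply/le_anti; rewrite cnorm_ge0 andbT.
  apply/ler_addgt0Pl => e e0; rewrite addr0.
  (* The relation involves [sylvester n] copies of coordinate [n.+1] and one of coordinate 0, each
     with error below [d]. *)
  pose d := e / (sylvester n).+1%:R.
  have d0 : 0 < d by rewrite divr_gt0.
  have [z _ fz] := close _ n.+2 d filterT d0.
  have fz1 := fz n.+1 (ltnSn _); have fz0 := fz 0%N (ltn0Sn _).
  have -> : to_circle (f n.+1) *+ sylvester n - to_circle (f 0%N) =
      (to_circle (f n.+1) - z n.+1) *+ sylvester n - (to_circle (f 0%N) - z 0%N).
    by rewrite mulrnBl solenoid_relation // opprB addrA subrK.
  have cnormMn (t : circle R) k : cnorm (t *+ k) <= cnorm t *+ k.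
    elim: k => [|k IHk]; first by rewrite !mulr0n cnorm0.
    by rewrite !mulrS (le_trans (cnorm_triangle _ _)) // lerD2l.
  apply: le_trans (cnorm_triangle _ _) _; rewrite cnormN.
  apply: le_trans (lerD (cnormMn _ _) (ltW fz0)) _.
  apply: le_trans (lerD (ler_wMn2r _ (ltW fz1)) (lexx _)) _.
  by rewrite -mulrSr -mulr_natr divfK // pnatr_eq0.
exists (Solenoid fS); split => // A B FA /nbhs_ballP[e /= e0 eB].
have e20 : 0 < e / 2 by rewrite divr_gt0.
have [N Ne] := exp2_small e20; have [z Az fz] := close A N _ FA e20.
exists z; split => //; apply: eB; rewrite ball_sdist /=.
have le_e2 : sdist (Solenoid fS) z <= e / 2 by apply: sdist_lt_eps Ne _.
by apply: le_lt_trans le_e2 _; rewrite ltr_pdivrMr // ltr_pMr // ltr1n.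
Qed.

(** By compactness a Cauchy sequence has a cluster point, which is then its limit. *)
Lemma solenoid_complete : complete_compatible_metric sdist.
Proof.
split.
- by move=> z w; split=> [/sdist_positivity|->]; last exact: sdistxx.
- exact: sdist_sym.
- by move=> z w t; exact: sdist_triangle.
- move=> z; by rewrite -(@filter_from_ballE R).
- move=> u cauchy_u.
  have [l [_ lcl]] := @solenoid_compact (u @ \oo) _ filterT.
  exists l; apply/cvg_ballP => e e0.
  have e20 : 0 < e / 2 by rewrite divr_gt0.
  have [N hN] := cauchy_u _ e20.
  have uN : (u @ \oo) (u @` [set n | (N <= n)%N]).
    by exists N => // n /= Nn; exists n.
  have [_ [[m /= Nm <-] lm]] := lcl _ _ uN (nbhsx_ballx l _ e20).
  exists N => // n /= Nn; rewrite ball_sdist /=.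
  apply: le_lt_trans (sdist_triangle (u m) _ _) _.
  by rewrite [e]splitr ltrD //; exact: hN.
Qed.

End Solenoid.

Lemma modn_int_div (R : realType) (a b q : nat) : (0 < q)%N ->
  a = b %[mod q] -> (a%:R - b%:R) / q%:R \is a @Num.int R.
Proof.
move=> q0; have qR : q%:R != 0 :> R by rewrite pnatr_eq0 -lt0n.
wlog ab : a b / (a <= b)%N => [hw|/esym/eqP].
  case: (leqP a b) => [|/ltnW] ab E; first exact: hw.
  by rewrite -opprB mulNr rpredN hw.
rewrite eqn_mod_dvd // => /dvdnP[d dE].
by rewrite -opprB -natrB // dE natrM mulNr mulfK // rpredN natr_int.
Qed.

(** * Lifts to the Lie algebra and one-parameter subgroups *)

Section Lift.
Variables (R : realType) (S : set nat).
Implicit Types v : nat -> R.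

(** The relations are imposed in the reals and not only modulo 1, so lifts can be scaled by any
    real. *)
Definition is_lift v := forall n, S n -> v n.+1 *+ sylvester n = v 0%N.

Definition sol_exp v : solenoid R S := insubd 0 (fun n => to_circle (v n)).

Lemma sol_expE v n : is_lift v -> sol_exp v n = to_circle (v n).
Proof.
move=> vS; rewrite /sol_exp val_insubd ifT //.
by apply/asboolP => k Sk; rewrite -to_circleMn vS.
Qed.

Lemma is_liftZ t v : is_lift v -> is_lift (fun n => t * v n).
Proof. by move=> vS n Sn; rewrite -mulrnAr vS. Qed.

Lemma sol_expMn v k : is_lift v -> (0 < k)%N ->
  sol_exp v = sol_exp (fun n => k%:R^-1 * v n) *+ k.
Proof.
move=> vS k0; apply: solenoid_eqP => n.
rewrite solenoidMn !sol_expE //; last exact: is_liftZ.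
by rewrite -to_circleMn -mulrnAr -[v n *+ k]mulr_natl mulKf // pnatr_eq0 -lt0n.
Qed.

Lemma sol_exp_continuous v B : is_lift v -> (forall n, `|v n| <= B) ->
  continuous (fun t : R => sol_exp (fun n => t * v n)).
Proof.
move=> vS vB t; apply/(@cvg_ballP R) => e e0.
(* [B] may be 0, hence the division by [B + 1]. *)
have B1 : 0 < B + 1 by rewrite ltr_wpDl // (le_trans _ (vB 0%N)).
have eB : 0 < e / (B + 1) by rewrite divr_gt0.
near=> s; have ts : `|t - s| < e / (B + 1).
  by near: s; exact: (@nbhsx_ballx R R t).
rewrite ball_sdist /=.
apply: le_lt_trans (_ : `|t - s| * (B + 1) < e); last by rewrite -ltr_pdivlMr.
apply/sdist_le => n; rewrite !sol_expE; try exact: is_liftZ.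
rewrite -to_circleB cnormE -mulrBl.
apply: le_trans (_ : int_dist ((t - s) * v n) <= _).
  rewrite ler_piMl ?int_dist_ge0 //.
  by rewrite invf_le1 ?exprn_gt0 // exprn_ege1 // ler1n.
apply: le_trans (int_dist_le_abs _) _; rewrite normrM ler_wpM2l //.
by rewrite (le_trans (vB n)) // lerDl.
Unshelve. all: by end_near. Qed.

End Lift.

(** * Density of the rational points and connectedness *)

Section RationalPoints.
Variables (R : realType) (Q : nat -> bool).

Definition unflagged : set nat := [set n | forall w, ~~ Q (npair w n)].

Local Notation G := (solenoid R unflagged).

Definition pt_lift (i n : nat) : R := (pt_num Q i n)%:R / (pt_den Q i n)%:R.

Definition pt (i : nat) : G := sol_exp unflagged (pt_lift i).

(** For [n] in [S] every candidate witness is wrong, so the forced value is taken; for other [n]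
    there is no relation to check. *)
Lemma pt_liftP i : is_lift unflagged (pt_lift i).
Proof.
move=> n Sn; have nf : flagged Q i n = false by exact/negbTE/Sn.
rewrite /pt_lift /pt_num /pt_den /= nf -[_ / _ *+ _]mulr_natr -mulrA.
congr (_ * _).
by rewrite natrM invfM divfK // pnatr_eq0.
Qed.

Lemma pt_lift_norm i n : `|pt_lift i n| <= i%:R.
Proof.
rewrite ger0_norm ?divr_ge0 // ler_pdivrMr ?ltr0n ?pt_den_gt0 //.
rewrite -natrM ler_nat (leq_trans (pt_num_leq _ _ _)) //.
by rewrite leq_pmulr // pt_den_gt0.
Qed.

Lemma pt0 : pt 0 = 0.
Proof.
apply: solenoid_eqP => n; rewrite sol_expE; last exact: pt_liftP.
by rewrite /pt_lift pt_num0 mul0r to_circle0.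
Qed.

Lemma circle_rep (z : circle R) (k : nat) :
  exists2 x : R, k%:R <= x < k%:R + 1 & to_circle x = z.
Proof.
have [x <-] := to_circle_surj z.
exists (x - (Num.floor x)%:~R + k%:R); last first.
  apply/to_circle_eq.
  have -> : x - (Num.floor x)%:~R + k%:R - x = (k%:Z - Num.floor x)%:~R.
    by rewrite intrB -pmulrn; ring.
  exact: intr_int.
have /andP[f1 f2] := floor_itv x; rewrite intrD in f2.
by rewrite lerDr subr_ge0 f1 /= addrC ltrD2l ltrBlDl.
Qed.

Lemma truncn_approx (b : nat) (x : R) : 0 <= x ->
  `|(Num.truncn (b.+1%:R * x))%:R / b.+1%:R - x| <= b.+1%:R^-1.
Proof.
move=> x0; have b0 : 0 < b.+1%:R :> R by [].
have /truncn_itv/andP[t1 t2] : 0 <= b.+1%:R * x by rewrite mulr_ge0.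
rewrite distrC ger0_norm; last by rewrite subr_ge0 ler_pdivrMr // [leRHS]mulrC.
rewrite -(ler_pM2r b0) mulrBl divfK ?gt_eqF // mulVf ?gt_eqF //.
by rewrite lerBlDl natr1 [leLHS]mulrC ltW.
Qed.

(** Let [t] and [w n] lift coordinates 0 and [n + 1] of [z]. For [n] in [S],
    [sylvester n * w n = t + k n] with an integer [k n]. Lifting coordinate 0 to [t + m], with [m]
    congruent to [k n] modulo [sylvester n] for all [n < N], makes the forced values equal to those
    of [z]; it remains to round to denominator [b + 1]. *)
Lemma pt_approx (z : G) e : 0 < e -> exists i, sdist (pt i) z < e.
Proof.
move=> e0; have e20 : 0 < e / 2 by rewrite divr_gt0.
have [N Ne] := exp2_small e20.
pose b := Num.truncn (e / 2)^-1.
have be : b.+1%:R^-1 < e / 2.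
  by rewrite -[ltRHS]invrK ltf_pV2 ?posrE ?invr_gt0 // truncnS_gt.
have [t /andP[t0 t1] tz] := circle_rep (z 0%N) 0.
(* Lifts that are at least 1 ensure [w n *+ sylvester n >= t], so that [k n] is a natural number. *)
have /choice[w hw] : forall n, exists x : R, 1 <= x /\ to_circle x = z n.+1.
  by move=> n; have [x /andP[x1 _] xz] := circle_rep (z n.+1) 1; exists x.
have /choice[k hk] : forall n, exists k : nat, unflagged n ->
    w n *+ sylvester n = t + k%:R.
  move=> n; case: (pselect (unflagged n)) => [Sn|]; last by exists 0%N.
  have /to_circle_eq/intrP[m wtm] : to_circle (w n *+ sylvester n) = to_circle t.
    by rewrite to_circleMn (hw n).2 tz solenoid_relation.
  have m0 : 0 <= m.
    rewrite -(ler_int R) -wtm subr_ge0; apply: le_trans (ltW t1) _.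
    rewrite add0r -[w n *+ _]mulr_natl.
    rewrite -[leLHS]mulr1 ler_pM ?(hw n).1 // ler1n sylvester_gt0 //.
  exists `|m|%N => _; rewrite -[w n *+ _](subrK t) wtm addrC.
  by rewrite -{1}(gez0_abs m0) -pmulrn.
have [m hm] := sylvester_chinese k N.
(* A true witness frees coordinate [n + 1] when [n] is outside [S]; otherwise any number serves. *)
have /choice[wit hwit] : forall n, exists u : nat, ~ unflagged n -> Q (npair u n).
  move=> n; case: (pselect (unflagged n)) => [Sn|]; first by exists 0%N.
  by move=> /existsNP[u /negP]; rewrite negbK; exists u.
pose a := Num.truncn (b.+1%:R * (t + m%:R)).
pose c := senc (mkseq (fun n =>
  npair (wit n) (Num.truncn (b.+1%:R * w n))) N).
exists (npair b (npair a c)).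
have tm0 : 0 <= t + m%:R by rewrite addr_ge0.
have a_approx : `|a%:R / b.+1%:R - (t + m%:R)| < e / 2.
  exact: le_lt_trans (truncn_approx b tm0) be.
apply: (@le_lt_trans _ _ (e / 2)); last first.
  by rewrite ltr_pdivrMr // ltr_pMr // ltr1n.
apply: sdist_lt_eps Ne _ => // -[|n] nN.
  rewrite sol_expE; last exact: pt_liftP.
  have -> : z 0%N = to_circle (t + m%:R).
    by rewrite to_circleD to_circle_nat addr0.
  rewrite -to_circleB cnormE; apply: le_lt_trans (int_dist_le_abs _) _.
  by rewrite /pt_lift /pt_num /pt_den /= !npairE.
rewrite sol_expE; last exact: pt_liftP.
have snthE : snth c n = npair (wit n) (Num.truncn (b.+1%:R * w n)).
  by rewrite snth_senc nth_mkseq // ltnW.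
rewrite /pt_lift /pt_num /pt_den /= /flagged !npairE snthE !npairE.
case: (pselect (unflagged n)) => [Sn|nSn]; last first.
  rewrite hwit // -(hw n).2 -to_circleB cnormE.
  apply: le_lt_trans (int_dist_le_abs _) _.
  apply: le_lt_trans (truncn_approx _ _) be.
  exact: le_trans ler01 (hw n).1.
rewrite (negbTE (Sn _)); set q := sylvester n.
have q0 : 0 < q%:R :> R by rewrite ltr0n.
(* The congruence between [m] and [k n] makes [(t + k n) / q] and [(t + m) / q] differ by an
   integer. *)
have -> : z n.+1 = to_circle ((t + m%:R) / q%:R).
  rewrite -(hw n).2; apply/to_circle_eq.
  have -> : w n = (t + (k n)%:R) / q%:R.
    by rewrite -hk // -[w n *+ _]mulr_natr mulfK // gt_eqF.
  rewrite -mulrBl opprD addrACA subrr add0r.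
  by apply: modn_int_div => //; exact/esym/hm/ltnW.
rewrite -to_circleB cnormE natrM invfM mulrA -mulrBl.
apply: le_lt_trans (int_dist_le_abs _) _; rewrite normrM.
apply: le_lt_trans a_approx; apply: ler_piMr => //.
by rewrite ger0_norm ?invr_ge0 ?ler0n // invf_le1 // ler1n.
Qed.

Lemma pt_dense : dense (range pt).
Proof.
move=> O [z Oz] oO; have /nbhs_ballP[e /= e0 eO] := open_nbhs_nbhs (conj oO Oz).
have [i iz] := pt_approx z e0; exists (pt i); split; last by exists i.
by apply: eO; rewrite ball_sdist /= sdist_sym.
Qed.

Lemma solenoid_connected : connected [set: G].
Proof.
pose path i := (fun t : R => sol_exp unflagged (fun n => t * pt_lift i n)).
pose A := \bigcup_i (path i @` setT).
have -> : [set: G] = closure A.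
  apply/seteqP; split=> // z _ W zW; have /nbhs_ballP[e /= e0 eW] := zW.
  have [i iz] := pt_approx z e0; exists (pt i); split; last first.
    by apply: eW; rewrite ball_sdist /= sdist_sym.
  exists i => //; exists 1 => //; rewrite /path /pt; congr sol_exp.
  by apply/funext => n; rewrite mul1r.
apply/connected_closure/bigcup_connected.
  exists 0 => i _; exists 0 => //; apply: solenoid_eqP => n; rewrite sol_expE.
    by rewrite mul0r to_circle0.
  exact/is_liftZ/pt_liftP.
move=> i _; apply: connected_continuous_connected.
  by apply/connected_intervalP => x y z.
apply: continuous_subspaceT.
exact: sol_exp_continuous (@pt_liftP i) (pt_lift_norm i).
Qed.

Lemma solenoid_polish : polish R G.
Proof.
split; last by exists (@sdist R unflagged); exact: solenoid_complete.
by exists (range pt); [exact: card_image_le|exact: pt_dense].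
Qed.

End RationalPoints.

(** * The dual *)

Section DualTheory.
Variables (R : realType) (G : topologicalZmodType).
Implicit Types chi psi : dual R G.

Lemma dual_continuous chi : continuous chi.
Proof. by case: chi => f /= /asboolP[]. Qed.

Lemma dualD chi x y : chi (x + y) = chi x + chi y.
Proof. by case: chi => f /= /asboolP[_ ->]. Qed.

Lemma dual_eqP chi psi : chi =1 psi -> chi = psi.
Proof. by move=> eq; apply/val_inj/funext. Qed.

Lemma dual0E x : (0 : dual R G) x = 0. Proof. by []. Qed.
Lemma dualDE chi psi x : (chi + psi) x = chi x + psi x. Proof. by []. Qed.
Lemma dualMnE chi n x : (chi *+ n) x = chi x *+ n.
Proof. by elim: n => [|n IHn]; rewrite ?mulr0n // !mulrS dualDE IHn. Qed.

Lemma dual0 chi : chi 0 = 0.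
Proof. by apply: (addIr (chi 0)); rewrite -dualD !add0r. Qed.

Lemma dualMn chi x n : chi (x *+ n) = chi x *+ n.
Proof.
by elim: n => [|n IHn]; rewrite ?mulr0n ?dual0 // !mulrS dualD IHn.
Qed.

(** The hypothesis at all multiples of [x] confines all multiples of [chi x - psi x] to the ball of
    radius [1/4]. *)
Lemma dual_close_eq chi psi :
  (forall x, cnorm (chi x - psi x) < 4^-1) -> chi = psi.
Proof.
move=> close; apply: dual_eqP => x; apply/eqP; rewrite -subr_eq0; apply/eqP.
by apply: no_small_subgroup => n; rewrite mulrnBl -!dualMn.
Qed.

Lemma cnorm_closed_ball (z : circle R) r :
  closed [set w : circle R | cnorm (w - z) <= r].
Proof.
move=> w clw; rewrite /= leNgt; apply/negP => rw.
have e0 : 0 < cnorm (w - z) - r by rewrite subr_gt0.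
have : nbhs w [set v | cnorm (v - w) < cnorm (w - z) - r].
  by apply/circle_nbhsP; eexists; first exact: e0.
move=> /clw[v [/= vz vw]].
have := cnorm_triangle (v - z) (w - v); rewrite [v - z + _]addrC subrKA.
by rewrite -(cnormN (w - v)) opprB; move: vw vz; lra.
Qed.

(** The circle is covered by the 16 closed arcs of radius 1/16 around the
    multiples of 1/16; their preimages under a character [chi] are compact, and
    a character mapping each of them into the concentric open arc of radius 1/8
    is everywhere within 3/16 of [chi]. *)
Lemma dual_discrete : compact [set: G] -> discrete (dual R G).
Proof.
move=> cptG; apply/funext => chi; apply/seteqP; split=> A.
  by move=> /nbhs_singleton Achi; exact/principal_filterP.
move/principal_filterP => Achi.
suff nbhs1 : nbhs chi [set chi] by apply: filterS nbhs1 => _ ->.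
pose c (j : nat) : circle R := to_circle (j%:R / 16).
pose K j := [set x : G | cnorm (chi x - c j) <= 16^-1].
pose U j := [set w : circle R | cnorm (w - c j) < 8^-1].
pose W j := [set psi : dual R G | dual_fun psi @` K j `<=` U j].
have cptK j : compact (K j).
  apply: (subclosed_compact _ cptG) => //.
  apply: (@preimage_closed _ _ chi [set w | cnorm (w - c j) <= 16^-1]).
    by move=> x _; exact: dual_continuous.
  exact: cnorm_closed_ball.
have nbhsW j : nbhs chi (W j).
  apply: open_nbhs_nbhs; split.
    by exists [set g | g @` K j `<=` U j] => //;
      apply: compact_open_open => //; exact: cnorm_open.
  by move=> _ [x Kx <-]; apply: le_lt_trans Kx _; lra.
have nbhsWn n : nbhs chi [set psi | forall j, (j < n)%N -> W j psi].
  elim: n => [|n IHn]; first exact: filterS filterT.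
  apply: filterS (filterI IHn (nbhsW n)) => psi /= [IH Wn] j.
  by rewrite ltnS leq_eqVlt => /orP[/eqP->|/IH].
apply: filterS (nbhsWn 16) => psi Wpsi /=; apply: dual_close_eq => x.
have [t /andP[t0 t1] tx] := circle_rep (chi x) 0.
rewrite mulr0n in t0; rewrite mulr0n add0r in t1.
have /andP[j1 j2] : (Num.truncn (16 * t))%:R <= 16 * t
    < (Num.truncn (16 * t)).+1%:R.
  by apply: truncn_itv; rewrite mulr_ge0.
set j := Num.truncn _ in j1 j2; have j16 : (j < 16)%N.
  rewrite -(ltr_nat R); apply: le_lt_trans j1 _.
  by rewrite -[ltRHS]mulr1 ltr_pM2l.
have Kx : K j x.
  rewrite /K /= -tx -to_circleB cnormE; apply: le_trans (int_dist_le_abs _) _.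
  have j3 : 16 * t < j%:R + 1 by rewrite natr1.
  by rewrite ger0_norm; lra.
have Ux : U j (psi x) by apply: (Wpsi j j16); exists x.
have := cnorm_triangle (psi x - c j) (c j - chi x); rewrite subrKA.
move=> /le_lt_trans; apply; rewrite -(cnormN (c j - _)) opprB.
by move: Ux Kx; rewrite /U /K /=; lra.
Qed.

End DualTheory.

(** * Torsion and divisibility in the dual of the solenoid *)

Section SolenoidDual.
Variables (R : realType) (Q : nat -> bool).
Local Notation S := (unflagged Q).
Local Notation G := (solenoid R S).

Lemma solenoid_coord_character n : (fun z : G => z n) \in @character R G.
Proof. by apply/asboolP; split=> //; exact: solenoid_coord_continuous. Qed.

Definition solenoid_coord n : dual R G := Character (solenoid_coord_character n).

Lemma solenoid_dual_torsion_free : torsion_free (dual R G).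
Proof.
move=> chi n n0 chin; apply: dual_eqP => z; rewrite dual0E.
apply: cnorm_eq0; apply/le_anti; rewrite cnorm_ge0 andbT.
apply/ler_addgt0Pl => e e0; rewrite addr0.
have : nbhs z [set w | cnorm (chi w - chi z) < e].
  apply: (@dual_continuous _ _ chi z [set u | cnorm (u - chi z) < e]).
  by apply/circle_nbhsP; exists e.
move=> /nbhs_ballP[r /= r0 rW]; have [i iz] := pt_approx z r0.
have : cnorm (chi (pt R Q i) - chi z) < e.
  by apply: rW; rewrite ball_sdist /= sdist_sym.
(* The dense point is [n] times another point [y], and [chi] takes on it the value of [chi *+ n] at
   [y], which is 0. *)
rewrite /pt (sol_expMn (@pt_liftP R Q i) n0) dualMn -dualMnE chin dual0E sub0r.
by rewrite cnormN => /ltW.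
Qed.

(** For [n] in [S], coordinate [n.+1] is a quotient. For [n] outside [S], some point of [G] is
    killed by [q] and has coordinate 0 equal to [1/q]; a multiple [chi *+ q] vanishes there, whereas
    coordinate 0 does not. *)
Lemma divides_solenoid_coord0 n :
  (exists chi : dual R G, chi *+ sylvester n = solenoid_coord 0) <-> S n.
Proof.
split=> [[chi chiE]|Sn]; last first.
  exists (solenoid_coord n.+1); apply: dual_eqP => z; rewrite dualMnE /=.
  exact: solenoid_relation.
apply: contrapT => nSn; set q := sylvester n.
have q0 : q%:R != 0 :> R by rewrite pnatr_eq0.
have inv_ex m : exists u : nat, m != n -> (u * sylvester m = 1 %[mod q])%N.
  (* A number divisible by [sylvester m] and congruent to 1 modulo [q] has as cofactor an inverse of
     [sylvester m] modulo [q]. *)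
  case: (eqVneq m n) => [_|mn]; first by exists 0%N.
  have cop := sylvester_coprime mn; pose x := chinese (sylvester m) q 0 1.
  have /eqP : x = 0 %[mod sylvester m] by exact: chinese_modl.
  rewrite mod0n => /dvdnP[u uE]; exists u => _; rewrite -uE.
  exact: chinese_modr.
have {inv_ex}/choice[u hu] := inv_ex.
(* For [m] in [S], coordinate [m.+1] must give [1/q] after multiplication by [sylvester m];
   [u m / q] does so and is still killed by [q]. Coordinate [n.+1] is unconstrained. *)
pose f k : circle R := if k is m.+1 then
    if m == n then 0 else to_circle ((u m)%:R / q%:R)
  else to_circle (q%:R^-1).
have fS : f \in @solenoid_pred R S.
  apply/asboolP => m Sm /=; have mn : m != n by apply: contra_notN nSn => /eqP<-.
  rewrite (negbTE mn) -to_circleMn; apply/to_circle_eq.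
  have := modn_int_div R (sylvester_gt0 n) (hu m mn).
  by rewrite natrM mulrBl mul1r mulrAC mulr_natr.
have := congr1 (fun psi : dual R G => psi (Solenoid fS)) chiE.
rewrite dualMnE -dualMn.
have -> : Solenoid fS *+ q = 0.
  apply: solenoid_eqP => -[|m]; rewrite solenoidMn solenoid0 /=.
    by rewrite -to_circleMn -[_^-1 *+ _]mulr_natr mulVf // (to_circle_nat R 1).
  case: ifP => _; first by rewrite mul0rn.
  by rewrite -to_circleMn -[_ / _ *+ _]mulr_natr divfK // to_circle_nat.
rewrite dual0 /= -to_circle0 => /esym/to_circle_eq; rewrite subr0.
move=> /intrP[m mE].
have q1 : 1 < q%:R :> R by rewrite ltr1n sylvester_gt1.
have : 0 < m%:~R :> R by rewrite -mE invr_gt0 (lt_trans ltr01).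
rewrite ltr0z gtz0_ge1 -(ler_int R) -mE.
by rewrite leNgt invf_lt1 ?q1 // (lt_trans ltr01).
Qed.

Lemma presentation_ce :
  has_computable_presentation (dual R G) ->
  exists e, forall n, S n <-> halts e [:: n].
Proof.
move=> [D [add [opp [phi [[eD hD] [ea ha] _]]]]].
move=> [phiD phi_inj phi_surj] [phi_add _].
pose c := phi (solenoid_coord 0).
have Dphi chi : D (phi chi) by exact: phiD.
(* The program for [add] is only reliable on [D]. The retraction [rho] onto [D] is computable
   because [D] is, and makes the search total. *)
pose rho m := if `[< D m >] then m else c.
have Drho m : D (rho m) by rewrite /rho; case: asboolP => // _; exact: Dphi.
have rhoE m : D m -> rho m = m by move=> Dm; rewrite /rho asboolT.
have cf_rho I (f : I -> seq nat) g : cf f g -> cf f (fun i => rho (g i)).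
  apply: cf_comp1; rewrite /rho; apply: cf_if; cf.
  by exists eD => i; exact: hD.
pose mult := fix mult k m :=
  if k is k'.+1 then add (mult k' m) (rho m) else phi 0.
have Dmult k m : D (mult k m).
  elim: k => //= k IHk; have [a _ <-] := phi_surj _ IHk.
  by have [b _ <-] := phi_surj _ (Drho m); rewrite -phi_add.
have multE k chi : mult k (phi chi) = phi (chi *+ k).
  by elim: k => //= k ->; rewrite rhoE // mulrSr phi_add.
have cf_mult : cf2 mult.
  (* [rho] is applied to the accumulator as well, so that the step is computable on all arguments;
     on values of [mult] it changes nothing. *)
  apply: (@cf_rec mult (fun=> phi 0) (fun _ a m => add (rho a) (rho m))) => //.
  - by move=> n m; rewrite /= (rhoE (mult n m)).
  - by cf.
  have [e1 h1] : cf code3 (fun p => rho p.1.2) by apply: cf_rho; cf.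
  have [e2 h2] : cf code3 (fun p => rho p.2) by apply: cf_rho; cf.
  exists (Comp ea [:: e1; e2]) => p; exists [:: rho p.1.2; rho p.2].
    by split; [exact: h1|split; [exact: h2|]].
  exact: ha.
apply: (@ce_search _ code1 S id
  (fun z => mult (sylvester (npair_snd z)) (rho (npair_fst z)) == c)).
- by cf.
- apply: cf_eq; cf; apply: (@cf_comp2 _ _ mult) => //.
    by apply: cf_sylvester; cf_all.
  by apply: cf_rho; cf_all.
move=> n; split=> [/divides_solenoid_coord0[chi chiE]|[m]].
  by exists (phi chi); rewrite !npairE rhoE // multE chiE.
rewrite !npairE => /eqP; have [chi _ <-] := phi_surj _ (Drho m).
rewrite multE => chiE; apply/divides_solenoid_coord0; exists chi.
by apply: phi_inj chiE; rewrite inE.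
Qed.

End SolenoidDual.

(** * The computably metrized presentation *)

Section ComputableMetric.
Variables (R : realType) (Q : nat -> bool).
Hypothesis hQ : cf1 (fun x => nat_of_bool (Q x)).
Local Notation S := (unflagged Q).
Local Notation G := (solenoid R S).
Local Notation x := (@pt R Q).
Local Notation d := (@sdist R S).

Lemma int_dist_frac (A B D : nat) : (0 < D)%N ->
  let r := (absdiff A B %% D)%N in
  int_dist ((A%:R - B%:R) / D%:R : R) =
    (if (r <= D - r)%N then r else (D - r)%N)%:R / D%:R.
Proof.
move=> D0; have DR : 0 < D%:R :> R by rewrite ltr0n.
wlog BA : A B / (B <= A)%N => [hw|] /=.
  case: (leqP B A) => [|/ltnW] le; first exact: hw.
  by rewrite -int_distN -mulNr opprB /absdiff addnC hw.
have -> : absdiff A B = (A - B)%N by rewrite /absdiff (eqP BA) addn0.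
rewrite -natrB //; move: (A - B)%N => e; set r := (e %% D)%N.
have rD : (r < D)%N by rewrite ltn_mod.
have -> : e%:R / D%:R = r%:R / D%:R + (Posz (e %/ D))%:~R :> R.
  rewrite -pmulrn {1}(divn_eq e D) -/r natrD natrM mulrDl mulfK ?gt_eqF //.
  by rewrite addrC.
rewrite int_distDint /int_dist.
have -> : Num.floor (r%:R / D%:R : R) = 0.
  apply: floor_def; rewrite add0r divr_ge0 //= ltr_pdivrMr // mul1r.
  by rewrite ltr_nat.
rewrite subr0 add0r minEle.
have -> : 1 - r%:R / D%:R = (D - r)%:R / D%:R :> R.
  by rewrite natrB ?(ltnW rD) // mulrBl mulfV ?gt_eqF.
by rewrite ler_pM2r ?invr_gt0 // ler_nat; case: ifP.
Qed.

Lemma pt_coord_gap i j l n :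
  cnorm ((x i + x j) n - x l n) = (gap Q i j l n)%:R / (sum_den Q i j l n)%:R.
Proof.
rewrite solenoidD !sol_expE; try exact: pt_liftP.
rewrite -to_circleD -to_circleB cnormE.
have Di := pt_den_gt0 Q i n; have Dj := pt_den_gt0 Q j n.
have Dl := pt_den_gt0 Q l n.
rewrite /gap -int_dist_frac; last by rewrite !muln_gt0 Di Dj Dl.
congr int_dist; rewrite /pt_lift /sum_num /sub_num /sum_den.
rewrite !(natrM, natrD); field.
by rewrite !pnatr_eq0 -!lt0n Di Dj Dl.
Qed.

Lemma approx_distP i j l k :
  (approx_dist Q i j l k)%:R / 2 ^+ k <= d (x i + x j) (x l)
    <= (approx_dist Q i j l k).+1%:R / 2 ^+ k.
Proof.
have k0 : 0 < 2 ^+ k :> R by rewrite exprn_gt0.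
pose E n : R := 2 ^- n * cnorm ((x i + x j) n - x l n).
have den0 n : (0 < sum_den Q i j l n * 2 ^ n)%N.
  by rewrite !muln_gt0 !pt_den_gt0 expn_gt0.
have EE n : E n * 2 ^+ k =
    (gap Q i j l n * 2 ^ k)%:R / (sum_den Q i j l n * 2 ^ n)%:R.
  rewrite /E pt_coord_gap !natrM !natrX; field.
  by rewrite expf_neq0 //= !pnatr_eq0 -!lt0n !pt_den_gt0.
apply/andP; split.
  rewrite ler_pdivrMr //; rewrite /approx_dist.
  apply: (big_ind (fun m : nat => m%:R <= _)).
  - by apply: mulr_ge0; [exact: sdist_ge0|exact: ltW].
  - by move=> a b ha hb; rewrite /maxn; case: ifP.
  move=> n _; apply: le_trans (_ : E n * 2 ^+ k <= _); last first.
    by rewrite ler_pM2r //; exact: sdist_term.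
  rewrite EE ler_pdivlMr ?ltr0n ?den0 // -natrM ler_nat.
  exact: leq_trunc_div.
apply/sdist_le => n; rewrite -/(E n) ler_pdivlMr //.
case: (leqP n k) => [nk|kn].
  rewrite EE ler_pdivrMr ?ltr0n ?den0 // -natrM ler_nat.
  apply: leq_trans (ltnW (ltn_ceil _ (den0 n))) _; rewrite leq_mul2r ltnS.
  apply/orP; right.
  exact: (leq_bigmax (Ordinal (nk : (n < k.+1)%N))).
(* For [n > k] the term is at most [2^-n], less than the one unit of error allowed. *)
apply: (@le_trans _ _ 1); last by rewrite ler1n.
rewrite /E mulrAC; apply: le_trans (_ : 1 * 1 <= 1); last by rewrite mulr1.
apply: ler_pM; [|exact: cnorm_ge0| |exact: cnorm_le1].
  by rewrite mulr_ge0 ?exprn_ge0 // invr_ge0 exprn_ge0.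
by rewrite mulrC ler_pdivrMr ?exprn_gt0 // mul1r ler_weXn2l ?ler1n // ltnW.
Qed.

Lemma sdist_uniformly_computable :
  uniformly_computable (fun i j => d (x i) (x j)).
Proof.
have computable3_cf (f : nat -> nat -> nat -> nat) : cf3 f -> computable3 f.
  by move=> [e he]; exists e => i j k; exact: (he (i, j, k)).
(* The second summand is [x 0 = 0], and the denominator [(2 ^ k).-1.+1] is [2 ^ k]. *)
exists (fun i j k => approx_dist Q i 0 j k), (fun _ _ _ => 0%N),
  (fun _ _ k => (2 ^ k).-1).
split.
- by apply: computable3_cf; apply: cf_approx_dist => //; cf.
- by apply: computable3_cf; cf.
- by apply: computable3_cf; apply: cf_pred; cf_all.
move=> i j k; rewrite prednK ?expn_gt0 // natrX subr0.
have := approx_distP i 0 j k; rewrite pt0 addr0 => /andP[h1 h2].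
rewrite ger0_norm ?subr_ge0 // lerBlDl.
by rewrite -[X in _ + X]mul1r -mulrDl natr1.
Qed.

(** [a.+1 / 2 ^ k + n1 / d1 + n2 / d2 <= n3 / d3], cleared of denominators *)
Definition radii_fit (a k n1 d1 n2 d2 n3 d3 : nat) : bool :=
  (a.+1 * (d1 * d2 * d3) + n1 * (2 ^ k * d2 * d3) + n2 * (2 ^ k * d1 * d3)
     <= n3 * (2 ^ k * d1 * d2))%N.

Lemma radii_fitP a k n1 d1 n2 d2 n3 d3 :
  (0 < d1)%N -> (0 < d2)%N -> (0 < d3)%N ->
  radii_fit a k n1 d1 n2 d2 n3 d3 =
    (a.+1%:R / 2 ^+ k + n1%:R / d1%:R + n2%:R / d2%:R <= n3%:R / d3%:R :> R).
Proof.
move=> h1 h2 h3; rewrite /radii_fit -(ler_nat R) !(natrD, natrM, natrX).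
have k0 : 0 < 2 ^+ k :> R by rewrite exprn_gt0.
have p1 : 0 < d1%:R :> R by rewrite ltr0n.
have p2 : 0 < d2%:R :> R by rewrite ltr0n.
have p3 : 0 < d3%:R :> R by rewrite ltr0n.
rewrite -[RHS](ler_pM2r (mulr_gt0 (mulr_gt0 (mulr_gt0 k0 p1) p2) p3)).
congr (_ <= _); field; rewrite !gt_eqF //.
Qed.

Lemma approx_center (p : G) (r : R) : 0 < r -> exists i t,
  d (x i) p < t.+1%:R^-1 /\ t.+1%:R^-1 < r.
Proof.
move=> r0; pose t := Num.truncn r^-1.
have tr : t.+1%:R^-1 < r.
  by rewrite -[ltRHS]invrK ltf_pV2 ?posrE ?invr_gt0 ?truncnS_gt.
have [i ip] : exists i, d (x i) p < t.+1%:R^-1.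
  by apply: pt_approx; rewrite invr_gt0.
by exists i, t.
Qed.

(** The factor 5 divides the slack [r3 - d3] into five parts: one for the precision [v] and two for
    each of the radii [w] and [y], which also bound the displacements [d2] and [d1] of the
    centres. *)
Lemma linear_bound (r3 d1 d2 d3 d4 u v w y : R) :
  v * 5 < r3 - d3 -> w * 5 < r3 - d3 -> y * 5 < r3 - d3 ->
  d2 <= w -> d1 <= y -> u <= d4 -> d4 <= d3 + (d2 + d1) -> u + v + w + y <= r3.
Proof. lra. Qed.

(** [F] collects the inclusions certified by the triangle inequality: both radii plus an upper
    bound, at some precision [k], for the distance from the sum of the centres to the target centre
    fit into the target radius. *)
Lemma add_effectively_continuous :
  effectively_continuous ball_code2 (basic_ball2 x d)
    ball_code (basic_ball x d) (fun p : G * G => p.1 + p.2).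
Proof.
pose F : set (ball_name * ball_name * ball_name) := [set b | exists k,
  radii_fit (approx_dist Q (centre b.1.1) (centre b.1.2) (centre b.2) k) k
    (radius_num b.1.1).+1 (radius_den b.1.1).+1
    (radius_num b.1.2).+1 (radius_den b.1.2).+1
    (radius_num b.2).+1 (radius_den b.2).+1].
exists F; split.
- pose c (b : ball_name * ball_name * ball_name) :=
    ball_code2 b.1 ++ ball_code b.2.
  pose e b := nth 0%N (c b).
  apply: (@ce_search _ c F (fun b => senc [:: e b 0; e b 1; e b 2; e b 3; e b 4;
      e b 5; e b 6; e b 7; e b 8]%N) (fun z => let k := npair_fst z in
      let n := snth (npair_snd z) in
      radii_fit (approx_dist Q (n 0) (n 3) (n 6) k) k
        (n 1).+1 (n 2).+1 (n 4).+1 (n 5).+1 (n 7).+1 (n 8).+1)%N).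
  + by rewrite /senc /=; do !apply: cf_pair; try exact: cf_nth; cf.
  + rewrite /radii_fit; cf_all.
    by apply: cf_approx_dist => //; cf_all.
  + by move=> b; split=> -[k kP]; exists k; move: kP; cbv zeta;
      rewrite npair_fstK npair_sndK !snth_senc.
- move=> [b1 b2] b3 [k /=]; rewrite radii_fitP // => le_r3.
  move=> _ [[p q] [/= p1 q2] <-]; rewrite /basic_ball /= in p1 q2 *.
  apply: lt_le_trans le_r3.
  apply: le_lt_trans (sdist_triangle (x (centre b1) + x (centre b2)) _ _) _.
  rewrite -addrA ler_ltD //; last first.
    exact: le_lt_trans (sdistDD _ _ _ _) (ltrD p1 q2).
  by rewrite sdist_sym; have /andP[] := approx_distP
    (centre b1) (centre b2) (centre b3) k.
move=> [p q] b3 /=; rewrite /basic_ball /=; set r3 := _ / _ => lt_r3.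
have e0 : 0 < (r3 - d (x (centre b3)) (p + q)) / 5.
  by rewrite divr_gt0 // subr_gt0.
have [i [t [ip te]]] := approx_center p e0.
have [j [s [jq se]]] := approx_center q e0.
have [k ke] := exp2_small e0.
exists (BallName i 0 t, BallName j 0 s).
  by split; rewrite /basic_ball /= mul1r.
exists k => /=; rewrite radii_fitP // -/r3 !mul1r.
have /andP[h1 _] := approx_distP i j (centre b3) k.
have h2 : d (x i + x j) (x (centre b3)) <=
    d (x (centre b3)) (p + q) + (d (x i) p + d (x j) q).
  apply: le_trans (sdist_triangle (p + q) _ _) _.
  by rewrite addrC sdist_sym lerD2l sdistDD.
rewrite -natr1 mulrDl mul1r.
move: ke te se (ltW ip) (ltW jq) h1 h2.
rewrite ltr_pdivlMr // ltr_pdivlMr // ltr_pdivlMr //.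
exact: linear_bound.
Qed.

Lemma opp_effectively_continuous :
  effectively_continuous ball_code (basic_ball x d)
    ball_code (basic_ball x d) (fun p : G => - p).
Proof.
pose F : set (ball_name * ball_name) := [set b | exists k,
  radii_fit (approx_dist Q (centre b.1) (centre b.2) 0 k) k
    (radius_num b.1).+1 (radius_den b.1).+1 0 1
    (radius_num b.2).+1 (radius_den b.2).+1].
(* Translation invariance turns the distance needed for inversion into one that [approx_dist]
   already handles. *)
have dist_opp i l : d (- x i) (x l) = d (x i + x l) (x 0).
  by rewrite pt0 -[- x i]sub0r sdist_shift addrC sdist_sym.
exists F; split.
- pose c (b : ball_name * ball_name) := ball_code b.1 ++ ball_code b.2.
  pose e b := nth 0%N (c b).
  apply: (@ce_search _ c F
    (fun b => senc [:: e b 0; e b 1; e b 2; e b 3; e b 4; e b 5]%N)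
    (fun z => let k := npair_fst z in let n := snth (npair_snd z) in
      radii_fit (approx_dist Q (n 0) (n 3) 0 k) k
        (n 1).+1 (n 2).+1 0 1 (n 4).+1 (n 5).+1)%N).
  + by rewrite /senc /=; do !apply: cf_pair; try exact: cf_nth; cf.
  + rewrite /radii_fit; cf_all.
    by apply: cf_approx_dist => //; cf_all.
  + by move=> b; split=> -[k kP]; exists k; move: kP; cbv zeta;
      rewrite npair_fstK npair_sndK !snth_senc.
- move=> b1 b3 [k /=]; rewrite radii_fitP // mul0r addr0 => le_r3.
  move=> _ [p p1 <-]; rewrite /basic_ball /= in p1 *.
  apply: lt_le_trans le_r3.
  apply: le_lt_trans (sdist_triangle (- x (centre b1)) _ _) _.
  rewrite sdist_opp ler_ltD // sdist_sym dist_opp.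
  by have /andP[] := approx_distP (centre b1) (centre b3) 0 k.
move=> p b3 /=; rewrite /basic_ball /=; set r3 := _ / _ => lt_r3.
have e0 : 0 < (r3 - d (x (centre b3)) (- p)) / 5.
  by rewrite divr_gt0 // subr_gt0.
have [i [t [ip te]]] := approx_center p e0.
have [k ke] := exp2_small e0.
exists (BallName i 0 t); first by rewrite /basic_ball /= mul1r.
exists k => /=; rewrite radii_fitP // -/r3 mul1r mul0r addr0.
have /andP[h1 _] := approx_distP i (centre b3) 0 k.
have h2 : d (x i + x (centre b3)) (x 0) <= d (x (centre b3)) (- p) + d (x i) p.
  rewrite -dist_opp; apply: le_trans (sdist_triangle (- p) _ _) _.
  by rewrite addrC sdist_sym sdist_opp.
rewrite -natr1 mulrDl mul1r -[leLHS]addr0.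
move: ke te ip h1; rewrite ltr_pdivlMr // ltr_pdivlMr // => ke te ip h1.
(* The missing second operand enters [linear_bound] as a ball of radius 0 with displacement 0. *)
have e1 : 0 * 5 < r3 - d (x (centre b3)) (- p) by rewrite mul0r subr_gt0.
apply: (@linear_bound _ 0 _ _ _ _ _ _ _ ke te e1 (ltW ip) (lexx _) h1).
by rewrite addr0.
Qed.

Lemma solenoid_presentation : computably_metrized_presentation x d.
Proof.
split.
- exact: pt_dense.
- exact: solenoid_complete.
- exact: sdist_uniformly_computable.
- exact: add_effectively_continuous.
- exact: opp_effectively_continuous.
Qed.

End ComputableMetric.

Theorem theorem1p5 (R : realType) :
  exists G : topologicalZmodType,
    [/\ compact [set: G], connected [set: G], polish R G,
        exists (x : nat -> G) (d : G -> G -> R),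
          computably_metrized_presentation x d
      & [/\ discrete (dual R G), torsion_free (dual R G)
          & ~ has_computable_presentation (dual R G)]].
Proof.
(* [Q] is the decidable matrix of the diagonal halting set, so [unflagged Q] is the complement of
   that set. *)
have [Q cfQ diagQ] := sigma1_diagonal.
exists (solenoid R (unflagged Q)); split.
- exact: solenoid_compact.
- exact: solenoid_connected.
- exact: solenoid_polish.
- by exists (@pt R Q), (@sdist R (unflagged Q)); exact: solenoid_presentation.
split.
- exact/dual_discrete/solenoid_compact.
- exact: solenoid_dual_torsion_free.
move=> /presentation_ce[e he]; apply: co_diagonal_not_ce; exists e => n.
rewrite -he diagQ; split=> [nQ w|Sn [w Qw]]; last by have := Sn w; rewrite Qw.
by apply/negP => Qw; apply: nQ; exists w.
Qed.
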